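(* In the OSC model with unknown variance $\sigma^2$, there exists a universal positive constant $c$ such that the following holds. For any integer $n\ge 2$, any $\alpha\in(0,0.4)$, $\theta\in\mathbb R$, $\sigma>0$, any $\pi\in\overline{\mathcal M}_{\lfloor0.9n\rfloor}$ and any integer $k_0$ with $n_1(\pi)\le k_0\le\lfloor0.9n\rfloor$, $$\Big(\mathbb E_{\theta,\pi,\sigma}\big(\mathrm{FDP}(\pi,\mathrm{BH}_\alpha(\widetilde\theta_+,\widetilde\sigma_+))\big)-\frac{n_0(\pi)}{n}\alpha\Big)_+\le c\,\frac{\log n}{n^{1/16}}.$$ Additionally, let $\alpha\in(0,0.4)$. For any sequence $\epsilon_n\in(0,1)$ tending to zero with $\epsilon_n\gg\log^{-1/2}(n)$ (i.e. $\epsilon_n\log^{1/2}(n)\to\infty$), and any sequences $\pi=\pi_n$, $k_0=k_{0,n}$ with $n_1(\pi_n)\le k_{0,n}\le\lfloor0.9n\rfloor$ and $n_1(\pi_n)/n\asymp k_{0,n}/n$, we have for all $\theta\in\mathbb R$, $\sigma>0$, $$\limsup_n\Big\{\mathbb E_{\theta,\pi_n,\sigma}\big(\mathrm{TDP}(\pi_n,\mathrm{BH}^\star_\alpha)\big)-\mathbb E_{\theta,\pi_n,\sigma}\big(\mathrm{TDP}(\pi_n,\mathrm{BH}_{\alpha(1+\epsilon_n)}(\widetilde\theta_+,\widetilde\sigma_+))\big)\Big\}\le0.$$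
   Context: One-sided contamination (OSC) model: $Y_i=\theta+\sigma\varepsilon_i$, $1\le i\le n$, with $\theta\in\mathbb R$, $\sigma>0$, and $\varepsilon_1,\dots,\varepsilon_n$ independent, $\varepsilon_i\sim\pi_i$, $\pi=\otimes_i\pi_i$; $\mathbb E_{\theta,\pi,\sigma}$ denotes expectation. For distributions $P,Q$ on $\mathbb R$, $P\succeq Q$ means $F_P(x)\le F_Q(x)$ for all $x$ (c.d.f.s), and $P\succ Q$ means moreover $F_P(x)<F_Q(x)$ for some $x$. $\overline{\mathcal M}_k=\{\pi=\otimes_{i=1}^n\pi_i:\ \pi_i\succeq\mathcal N(0,1)\ \forall i,\ \sum_i\mathbf 1\{\pi_i\succ\mathcal N(0,1)\}\le k\}$. $\mathcal H_0(\pi)=\{i:\pi_i=\mathcal N(0,1)\}$, $\mathcal H_1(\pi)=\{i:\pi_i\succ\mathcal N(0,1)\}$, $n_0(\pi)=|\mathcal H_0(\pi)|$, $n_1(\pi)=|\mathcal H_1(\pi)|$. For $R\subset\{1,\dots,n\}$, $$\mathrm{FDP}(\pi,R)=\frac{|R\cap\mathcal H_0(\pi)|}{|R|\vee1},\qquad \mathrm{TDP}(\pi,R)=\frac{|R\cap\mathcal H_1(\pi)|}{n_1(\pi)\vee1}.$$ $Y_{(q)}$ is the $q$-th smallest of $Y_1,\dots,Y_n$; $\overline\Phi$ is the upper tail function of $\mathcal N(0,1)$. With $q_n=\lfloor n^{3/4}\rfloor$, $q'_n=\lfloor n^{1/4}\rfloor$ and tuning parameter $k_0$, $$\widetilde\sigma_+=\frac{Y_{(q_n)}-Y_{(q'_n)}}{\overline\Phi^{-1}(q'_n/(n-k_0))-\overline\Phi^{-1}(q_n/n)},\qquad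 \widetilde\theta_+=Y_{(q_n)}+\widetilde\sigma_+\,\overline\Phi^{-1}(q_n/n)$$ (for the finitely many small $n$ for which this is ill-defined, any convention may be used). For $u\in\mathbb R$, $s>0$, $p_i(u,s)=\overline\Phi((Y_i-u)/s)$; $0=p_{(0)}(u,s)\le p_{(1)}(u,s)\le\dots\le p_{(n)}(u,s)$ are the ordered values. Benjamini–Hochberg procedure at level $\alpha$: $\widehat\ell_\alpha(u,s)=\max\{\ell\in\{0,\dots,n\}:\ p_{(\ell)}(u,s)\le\alpha\ell/n\}$ and $\mathrm{BH}_\alpha(u,s)=\{i:\ p_i(u,s)\le\alpha\widehat\ell_\alpha(u,s)/n\}$. The oracle is $\mathrm{BH}^\star_\alpha=\mathrm{BH}_\alpha(\theta,\sigma)$. $(x)_+=\max(x,0)$; $u_n\asymp v_n$ means each is bounded by a positive constant (not depending on $n$) times the other. *)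

(* Defs.v *)
From mathcomp Require Import all_boot all_order all_algebra.
From mathcomp Require Import all_classical all_reals all_analysis.
Import Order.TTheory GRing.Theory Num.Theory.
Import numFieldNormedType.Exports.

Set Implicit Arguments.
Unset Strict Implicit.
Unset Printing Implicit Defensive.

Local Open Scope classical_set_scope.
Local Open Scope ring_scope.

Section Distributions.
Context {R : realType}.
Implicit Types (x p : R) (Q : probability (measurableTypeR R) R).

Definition std_normal : probability (measurableTypeR R) R := normal_prob 0 1.

Definition cdf_of Q x : \bar R := Q `]-oo, x]%classic.

(* Q stochastically dominates N(0,1), resp. strictly. *)
Definition dominates_normal Q : Prop :=
  forall x, (cdf_of Q x <= cdf_of std_normal x)%E.
Definition sdominates_normal Q : Prop :=
  dominates_normal Q /\ exists x, (cdf_of Q x < cdf_of std_normal x)%E.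

(* A measure is a function on all sets, with no control on its values outside
   the sigma-algebra: equality of distributions is equality on measurable sets. *)
Definition same_distribution Q1 Q2 : Prop :=
  forall A : set (measurableTypeR R), measurable A -> Q1 A = Q2 A.

Definition Phibar x : R := fine (std_normal `]x, +oo[%classic).

(* The inverse of Phibar on ]0, 1[; equal to 0 elsewhere. *)
Definition Phibar_inv p : R := xget 0 [set x | Phibar x = p].

End Distributions.

Section Model.
Context {R : realType} {n : nat}.
Implicit Type pi : 'I_n -> probability (measurableTypeR R) R.

Definition H0 pi : {set 'I_n} :=
  [set i | `[< same_distribution (pi i) std_normal >]]%SET.
Definition H1 pi : {set 'I_n} := [set i | `[< sdominates_normal (pi i) >]]%SET.
Definition n0 pi : nat := #|H0 pi|.
Definition n1 pi : nat := #|H1 pi|.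

Definition Mbar (k : nat) pi : Prop :=
  (forall i, dominates_normal (pi i)) /\ (n1 pi <= k)%N.

Definition FDP pi (S : {set 'I_n}) : R :=
  #|S :&: H0 pi|%:R / (maxn #|S| 1)%:R.
Definition TDP pi (S : {set 'I_n}) : R :=
  #|S :&: H1 pi|%:R / (maxn (n1 pi) 1)%:R.

Definition mutually_independent d (T : measurableType d) (P : probability T R)
    (eps : 'I_n -> {RV P >-> measurableTypeR R}) : Prop :=
  forall (J : {set 'I_n}) (B : 'I_n -> set (measurableTypeR R)),
    (forall i, measurable (B i)) ->
    P (\bigcap_(i in [set` J]) (eps i @^-1` B i)) =
    (\prod_(i in J) P (eps i @^-1` B i))%E.

(* The noise vector eps, defined on some probability space (T, P), is
   distributed as the product measure of the pi i. *)
Definition OSC_noise d (T : measurableType d) (P : probability T R) pi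
    (eps : 'I_n -> {RV P >-> measurableTypeR R}) : Prop :=
  mutually_independent eps /\
  forall i, same_distribution (distribution P (eps i)) (pi i).

Definition OSC_obs d (T : measurableType d) (P : probability T R)
    (theta sigma : R) (eps : 'I_n -> {RV P >-> measurableTypeR R})
    (w : T) (i : 'I_n) : R :=
  theta + sigma * eps i w.

End Model.

Section Procedures.
Context {R : realType} {n : nat}.
Implicit Types y p : 'I_n -> R.

(* The q-th smallest of the values of y, for 1 <= q <= n; equal to 0 if q = 0,
   as in the convention p_(0) = 0. *)
Definition order_stat y (q : nat) : R := nth 0 (0 :: sort <=%R (codom y)) q.

Definition qn : nat := Num.truncn ((n%:R : R) `^ (3 / 4)).
Definition qn' : nat := Num.truncn ((n%:R : R) `^ (1 / 4)).

(* For the finitely many n for which these are ill-defined, the values are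
   those given by x / 0 = 0 and by Phibar_inv p = 0 for p outside ]0, 1[. *)
Definition sigma_plus (k0 : nat) y : R :=
  (order_stat y qn - order_stat y qn') /
  (Phibar_inv (qn'%:R / (n%:R - k0%:R)) - Phibar_inv (qn%:R / n%:R)).
Definition theta_plus (k0 : nat) y : R :=
  order_stat y qn + sigma_plus k0 y * Phibar_inv (qn%:R / n%:R).

Definition pvalue y (u s : R) (i : 'I_n) : R := Phibar ((y i - u) / s).

Definition BH_ell (alpha : R) p : nat :=
  (\max_(l < n.+1 | (order_stat p l <= alpha * l%:R / n%:R)%R) l)%N.

Definition BH (alpha : R) y (u s : R) : {set 'I_n} :=
  let p := pvalue y u s in
  [set i | p i <= alpha * (BH_ell alpha p)%:R / n%:R]%SET.

Definition BH_plus (alpha : R) (k0 : nat) y : {set 'I_n} :=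
  BH alpha y (theta_plus k0 y) (sigma_plus k0 y).

End Procedures.

Definition same_order {R : realType} (u v : nat -> R) : Prop :=
  exists2 C : R, 0 < C &
    forall n, (2 <= n)%N -> u n <= C * v n /\ v n <= C * u n.

(* Main.v *)
(* By equivariance one may take theta = 0 and sigma = 1.

   Deviations.  Contamination only increases the observations, so by Chebyshev's
   inequality Y_(q) and Y_(q') stay, up to relative errors r = n^(-1/16) on the
   levels and outside an event of probability O(r^2), between the Gaussian
   quantiles for n observations and for n - k0 observations.  Dividing by the gap
   between the two quantiles, of order s = sqrt(ln n), this gives
     sigma_plus >= 1 - O(r / s^2)  and  theta_plus >= - O(r / s),
   and upper bounds with the bias k0/n + r in place of r.

   FDR.  A rejected Y_i exceeds Y_(q), so the estimators and the rejection set do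
   not change when Y_i is replaced by a larger outlier.  Hence, on the event that
   the estimators are good, i is rejected along with k others only if an event
   depending on the other observations holds and Y_i exceeds a deterministic
   threshold x_k.  By independence the expected FDP is at most
   O(r) + sum_i sum_k P(event_ik) Phibar(x_k) / (k+1), and the Gaussian tail at
   x_k is alpha (k+1) / n times 1 + O(r), up to n^(-3).

   Power.  If the oracle TDP is at least eta, the oracle threshold t is at least
   of order eta k0 / n.  Then the errors of the estimators on the quantile of t,
   multiplied by sqrt(ln 1/t), are O(1 / s) because x ln(1/x) is bounded: the
   p-values are inflated by a factor at most 1 + O(1 / s) <= 1 + eps_n, which the
   enlarged level absorbs, so that the oracle rejections are kept. *)
Require Import Defs.
From mathcomp Require Import all_boot all_order all_algebra.
From mathcomp Require Import all_classical all_reals all_analysis.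
From mathcomp Require Import measurable_realfun ring lra.
Import Order.TTheory GRing.Theory Num.Theory.
Import numFieldNormedType.Exports.

Set Implicit Arguments.
Unset Strict Implicit.
Unset Printing Implicit Defensive.

Local Open Scope classical_set_scope.
Local Open Scope ring_scope.

(** * The Gaussian tail and its inverse *)

Section GaussianTail.
Context {R : realType}.
Implicit Types (x z h p t : R).
Notation mu := (@lebesgue_measure R).
Notation phi := (normal_pdf (0 : R) 1).

Lemma phi0E x : phi x = normal_peak 1 * expR (- x ^+ 2 / 2).
Proof. by rewrite normal_pdfE ?oner_eq0// /normal_fun subr0 expr1n. Qed.

Lemma phi_gt0 x : 0 < phi x.
Proof. by rewrite phi0E mulr_gt0 ?normal_peak_gt0 ?oner_eq0 ?expR_gt0. Qed.

Lemma phiN x : phi (- x) = phi x.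
Proof. by rewrite !phi0E sqrrN. Qed.

Lemma phiD x h : phi (x + h) = phi x * expR (- x * h - h ^+ 2 / 2).
Proof. by rewrite !phi0E -mulrA -expRD; congr (_ * expR _); field. Qed.

Lemma phi_noninc x z : 0 <= x -> x <= z -> phi z <= phi x.
Proof.
move=> x0 xz; rewrite !phi0E ler_pM2l ?normal_peak_gt0 ?oner_eq0// ler_expR.
by rewrite !mulNr lerN2 ler_pM2r// lerXn2r ?nnegrE// (le_trans x0 xz).
Qed.

Lemma phi_le1 x : phi x <= 1.
Proof.
apply: (le_trans (normal_pdf_ub _ _ (oner_neq0 _))).
rewrite /normal_peak expr1n mul1r invf_le1; last first.
  by rewrite sqrtr_gt0 pmulrn_lgt0// pi_gt0.
rewrite -[leLHS]sqrtr1 ler_wsqrtr// mulr2n (le_trans _ (lerD (pi_ge2 R) (pi_ge2 R)))//.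
lra.
Qed.

Lemma continuous_phi : continuous (phi : R -> R).
Proof. exact: continuous_normal_pdf. Qed.

Lemma measurable_phi (D : set (measurableTypeR R)) :
  measurable_fun D (phi : measurableTypeR R -> measurableTypeR R).
Proof. by apply: measurable_funTS; exact: measurable_normal_pdf. Qed.

Lemma std_normalE (A : set R) :
  @std_normal R A = (\int[mu]_(x in A) (phi x)%:E)%E.
Proof. by []. Qed.

Lemma prob_itv_split (Q : probability (measurableTypeR R) R) (a b : R) : a <= b ->
  fine (Q `]a, +oo[%classic) = fine (Q `]a, b]%classic) + fine (Q `]b, +oo[%classic).
Proof.
move=> ab; rewrite -fineD ?fin_num_measure// -measureU//; last first.
  rewrite -subset0 => x /=; rewrite !in_itv/= => -[/andP[_ h1]].
  by rewrite andbT ltNge h1.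
congr (fine (Q _)); apply/seteqP; split => x /=; rewrite !in_itv/= !andbT.
  by move=> ax; case: (leP x b) => xb; [left; rewrite ax|right].
by case=> [/andP[]//|]; exact: le_lt_trans.
Qed.

Lemma prob_itvNy (Q : probability (measurableTypeR R) R) x :
  Q `]-oo, x]%classic = (1 - fine (Q `]x, +oo[%classic))%:E.
Proof.
rewrite -setCitvr probability_setC//.
by rewrite EFinB fineK// fin_num_measure.
Qed.

Lemma PhibarE x : (Phibar x)%:E = std_normal `]x, +oo[%classic.
Proof. by rewrite /Phibar fineK// fin_num_measure. Qed.

Lemma PhibarEc x : (Phibar x)%:E = std_normal `[x, +oo[%classic.
Proof.
rewrite PhibarE !std_normalE integral_itv_obnd_cbnd//.
by apply/measurable_EFinP; exact: measurable_phi.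
Qed.

Lemma std_normal_itv_bnd (a b : R) (m M : R) : a <= b ->
  (forall x, a < x <= b -> m <= phi x <= M) ->
  m * (b - a) <= fine (std_normal `]a, b]%classic) <= M * (b - a).
Proof.
move=> ab mM; rewrite -!lee_fin fineK ?fin_num_measure// !EFinM std_normalE.
have muab : mu `]a, b]%classic = (b - a)%:E.
  by rewrite lebesgue_measure_itv/= lte_fin; case: ltP => // ba;
    rewrite (@le_anti _ _ a b) ?ab// subrr.
have phi0 (x : R) : `]a, b]%classic x -> (0 <= (phi x)%:E)%E.
  by move=> _; rewrite lee_fin ltW// phi_gt0.
apply/andP; split.
- rewrite -muab -integral_cst//; case: (leP 0 m) => m0; last first.
    apply: (@le_trans _ _ 0%E); last exact: integral_ge0.
    by rewrite integral_cst//= [X in (_ * X)%E]muab -EFinM lee_fin mulr_le0_ge0 ?subr_ge0// ltW.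
  apply: ge0_le_integral => //.
  + by apply/measurable_EFinP; exact: measurable_phi.
  + by move=> x /=; rewrite in_itv/= => /mM /andP[]; rewrite lee_fin.
- rewrite -muab -integral_cst//.
  apply: ge0_le_integral => //.
  + by apply/measurable_EFinP; exact: measurable_phi.
  + by move=> x /=; rewrite in_itv/= => /mM /andP[]; rewrite lee_fin.
Qed.

Lemma Phibar_split (a b : R) : a <= b ->
  Phibar a = fine (std_normal `]a, b]%classic) + Phibar b.
Proof. exact: prob_itv_split. Qed.

Lemma Phibar_cdf x : cdf_of (@std_normal R) x = (1 - Phibar x)%:E.
Proof. exact: prob_itvNy. Qed.

Lemma Phibar_noninc x z : x <= z -> Phibar z <= Phibar x.
Proof. by move=> xz; rewrite (Phibar_split xz) lerDr fine_ge0. Qed.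

Lemma Phibar_ge0 x : 0 <= Phibar x.
Proof. by rewrite fine_ge0. Qed.

(* [1 / (z + 1)] is the scale on which the density at [z] drops by a constant factor. *)
Lemma phi_le_Phibar z : 0 <= z -> phi z <= 8 * (z + 1) * Phibar z.
Proof.
move=> z0; pose d := (z + 1)^-1.
have d0 : 0 < d by rewrite invr_gt0; lra.
have zd : z * d <= 1.
  by rewrite /d ler_pdivrMr; lra.
have dd : d ^+ 2 <= 1 by rewrite exprn_ile1//; [exact: ltW|rewrite /d invf_le1; lra].
have /andP[h _] := @std_normal_itv_bnd z (z + d) (phi (z + d)) 1 ltac:(lra)
  ltac:(by move=> x /andP[zx xz]; rewrite phi_le1 andbT phi_noninc//; lra).
have : phi (z + d) * d <= Phibar z.
  have zzd : z <= z + d by lra.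
  rewrite (Phibar_split zzd); apply: (le_trans _ (ler_wpDr (Phibar_ge0 _) h)).
  by rewrite addrAC subrr add0r.
rewrite phiD /d ler_pdivrMr; last by lra.
(* The exponent is at least [-3/2] because [z * d] and [d ^+ 2] are at most 1. The factor 8 is the
   cube of 2, from [exp(-1/2) >= 1/2]. *)
have e : expR (- (3 / 2)) <= expR (- z * d - d ^+ 2 / 2) by rewrite ler_expR; lra.
have e5 : 1 <= 8 * expR (- (3 / 2) : R).
  rewrite (_ : - (3 / 2) = - (1 / 2) *+ 3); last by rewrite -mulr_natr; field.
  rewrite -[X in expR X]mulr_natr expRM_natr; have := @expR_ge1Dx R (- (1 / 2)); set E := expR _ => hE.
  have : (1 / 2) ^+ 3 <= E ^+ 3 by rewrite lerXn2r// ?nnegrE; lra.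
  lra.
move=> H; have := phi_gt0 z; nra.
Qed.

Lemma Phibar_gt0 x : 0 < Phibar x.
Proof.
have : 0 < Phibar (Num.max x 0).
  have := @phi_le_Phibar (Num.max x 0); rewrite le_max lexx orbT => /(_ isT).
  have := phi_gt0 (Num.max x 0); have : 0 <= Num.max x 0 by rewrite le_max lexx orbT.
  have := Phibar_ge0 (Num.max x 0); nra.
by move=> /lt_le_trans; apply; apply: Phibar_noninc; rewrite le_max lexx.
Qed.

(** On []z - h, z]] the density is at most [phi z * expR (z * h)], and [phi_le_Phibar] trades
    [phi z] for the tail. This turns an error [h] on a quantile into a relative error on its
    level. *)
Lemma Phibar_drop z h : 0 <= h -> h <= z ->
  Phibar (z - h) <= Phibar z * (1 + 8 * (z + 1) * h * expR (z * h)).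
Proof.
move=> h0 hz.
have zh : z - h <= z by lra.
rewrite (Phibar_split zh) mulrDr mulr1 addrC lerD2l.
have /andP[_ H] := @std_normal_itv_bnd (z - h) z 0 (phi (z - h)) zh
  ltac:(by move=> x /andP[zx xz]; rewrite ltW ?phi_gt0//= phi_noninc//; lra).
apply: (le_trans H); rewrite opprB addrCA subrr addr0.
have -> : phi (z - h) = phi z * expR (z * h - h ^+ 2 / 2).
  by rewrite phiD; congr (_ * expR _); field.
have e1 : expR (z * h - h ^+ 2 / 2) <= expR (z * h) by rewrite ler_expR gerBl divr_ge0// sqr_ge0.
rewrite (_ : Phibar z * _ = (8 * (z + 1) * Phibar z) * expR (z * h) * h); last by ring.
rewrite ler_wpM2r//; apply: ler_pM; [exact/ltW/phi_gt0|exact: expR_ge0| |exact: e1].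
by apply: phi_le_Phibar; lra.
Qed.

Lemma Phibar_lip x z : x <= z -> Phibar x - Phibar z <= z - x.
Proof.
move=> xz; rewrite (Phibar_split xz) addrK.
have /andP[_] := @std_normal_itv_bnd x z 0 1 xz
  ltac:(by move=> y _; rewrite ltW ?phi_gt0//= phi_le1).
by rewrite mul1r.
Qed.

(** Translating the integral by [h] multiplies the density at [y] by [expR (- y * h - h ^+ 2 / 2)],
    which is largest at the left endpoint [y = x]. *)
Lemma Phibar_shift x h : 0 <= x -> 0 <= h ->
  Phibar (x + h) <= Phibar x * expR (- x * h - h ^+ 2 / 2).
Proof.
move=> x0 h0; rewrite -lee_fin EFinM !PhibarEc !std_normalE.
have D1 : (+%R^~ h : R -> R)^`()%classic = cst 1.
  apply/funext => u; rewrite derive1E; by case: (@is_derive_shift R u 1 h) => _ /=.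
have mphi (D : set (measurableTypeR R)) : measurable_fun D (EFin \o phi).
  by apply/measurable_EFinP; exact: measurable_phi.
rewrite (@increasing_ge0_integration_by_substitutiony _ (+%R^~ h) phi x).
- rewrite -ge0_integralZr//; last by move=> y ?; rewrite lee_fin ltW ?phi_gt0.
  apply: ge0_le_integral => //.
  + by move=> y _; rewrite D1 lee_fin mulr_ge0// ltW// phi_gt0.
  + rewrite D1; apply/measurable_EFinP; apply: measurable_funM => //.
    by apply: measurableT_comp; [exact: measurable_phi|exact: measurable_funD].
  + apply: emeasurable_funM => //; exact: mphi.
  + move=> y /=; rewrite in_itv/= andbT => xy.
    rewrite D1 -EFinM lee_fin (_ : (_ * _) y = phi ((y : R) + h)); last exact: mulr1.
    rewrite phiD ler_pM2l ?phi_gt0// ler_expR lerD2r.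
    by rewrite ler_wpM2r// lerN2.
- by move=> y z _ _; rewrite ltrD2r.
- by rewrite D1 => y _; exact: cst_continuous.
- by rewrite D1; exact: is_cvg_cst.
- by rewrite D1; exact: is_cvg_cst.
- split; first by [].
  by apply: cvg_at_right_filter; apply: cvgD; [exact: cvg_id|exact: cvg_cst].
- exact: cvg_addrr.
- by apply: continuous_subspaceT; exact: continuous_phi.
- by move=> y _; rewrite ltW ?phi_gt0.
Qed.

Lemma PhibarN x : Phibar (- x) = 1 - Phibar x.
Proof.
apply: EFin_inj; rewrite -Phibar_cdf PhibarEc /cdf_of !std_normalE.
have := @ge0_integration_by_substitutionNy R phi (- x); rewrite opprK => ->.
- by apply: eq_integral => y _ /=; rewrite phiN.
- by apply: continuous_subspaceT; exact: continuous_phi.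
- by move=> y _; rewrite ltW ?phi_gt0.
Qed.

Lemma Phibar0 : Phibar (0 : R) = 1 / 2.
Proof. by have := PhibarN 0; rewrite oppr0; lra. Qed.

Lemma Phibar_expR x : 0 <= x -> Phibar x <= expR (- x ^+ 2 / 2).
Proof.
move=> x0; have := @Phibar_shift 0 x (lexx _) x0.
rewrite add0r oppr0 mul0r sub0r Phibar0 mulNr => /le_trans; apply.
by have := expR_gt0 (- (x ^+ 2 / 2)); lra.
Qed.

Lemma Phibar_decr x z : x < z -> Phibar z < Phibar x.
Proof.
have pos (a b : R) : 0 <= a -> a < b -> Phibar b < Phibar a.
  move=> a0 ab; have h0 : 0 < b - a by lra.
  have := @Phibar_shift a (b - a) a0 (ltW h0); rewrite addrCA subrr addr0.
  move=> /le_lt_trans; apply; rewrite gtr_pMr ?Phibar_gt0// -[ltRHS]expR0 ltr_expR.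
  nra.
move=> xz; case: (leP 0 x) => x0; first exact: pos.
case: (leP z 0) => z0.
  have := @pos (- z) (- x) ltac:(lra) ltac:(lra).
  by rewrite !PhibarN; lra.
have := @pos 0 z (lexx _) z0; have := @pos 0 (- x) (lexx _) ltac:(lra).
by rewrite PhibarN Phibar0; lra.
Qed.

Lemma continuous_Phibar : continuous (Phibar : R -> R).
Proof.
move=> x; apply/cvgrPdist_le => /= e e0; near=> y.
have yx : `|x - y| <= e by near: y; exact: cvgr_dist_le.
case: (leP x y) => xy.
- rewrite ger0_norm; last by rewrite subr_ge0 Phibar_noninc.
  by apply: le_trans (Phibar_lip xy) _; rewrite -normrN opprB in yx; exact: le_trans (ler_norm _) yx.
- rewrite ler0_norm; last by rewrite subr_le0 Phibar_noninc// ltW.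
  by rewrite opprB; apply: le_trans (Phibar_lip (ltW xy)) _; exact: le_trans (ler_norm _) yx.
Unshelve. all: by end_near. Qed.

Lemma Phibar_inv_ex p : 0 < p < 1 -> exists x, Phibar x = p.
Proof.
have ub q : 0 < q -> exists2 b : R, 0 <= b & Phibar b <= q.
  (* At [x = q^-1 + 1] the bound [expR (x ^+ 2 / 2) >= 1 + x ^+ 2 / 2] already exceeds [q^-1]. *)
  move=> q0; exists (q^-1 + 1); first by rewrite addr_ge0// invr_ge0 ltW.
  apply: le_trans (Phibar_expR _) _; first by rewrite addr_ge0// invr_ge0 ltW.
  rewrite mulNr expRN invf_ple ?posrE ?expR_gt0//.
  apply: le_trans _ (expR_ge1Dx _).
  have : 0 < q^-1 by rewrite invr_gt0.
  nra.
move=> /andP[p0 p1].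
have [b b0 hb] := ub p p0; have [a a0 ha] := ub (1 - p) ltac:(lra).
have ab : - a <= b by lra.
have [||c _ <-] := @IVT R Phibar (- a) b p ab; last by exists c.
- by apply: continuous_subspaceT; exact: continuous_Phibar.
- rewrite PhibarN ge_min le_max hb; apply/andP; split; first by rewrite orbT.
  by apply/orP; left; lra.
Qed.

Lemma Phibar_invK p : 0 < p < 1 -> Phibar (Phibar_inv p) = p.
Proof. by move=> /Phibar_inv_ex [x hx]; rewrite /Phibar_inv; case: xgetP => // /(_ x). Qed.

Lemma Phibar_le x z : (Phibar x <= Phibar z) = (z <= x).
Proof.
case: (leP z x) => [/Phibar_noninc//|/Phibar_decr]; by rewrite ltNge => /negbTE.
Qed.

Lemma Phibar_inv_le p x : 0 < p < 1 -> (Phibar_inv p <= x) = (Phibar x <= p).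
Proof. by move=> hp; rewrite -[in RHS](Phibar_invK hp) Phibar_le. Qed.

Lemma Phibar_inv_ge p x : 0 < p < 1 -> (x <= Phibar_inv p) = (p <= Phibar x).
Proof. by move=> hp; rewrite -[in RHS](Phibar_invK hp) Phibar_le. Qed.

Lemma Phibar_inv_gt0 p : 0 < p -> p < 1 / 2 -> 0 < Phibar_inv p.
Proof.
move=> p0 p1; rewrite ltNge Phibar_inv_le; last by lra.
by rewrite Phibar0 -ltNge.
Qed.

(* The hazard rate of the Gaussian at [x >= 0] is at least [x]. *)
Lemma Phibar_inv_diff (a b : R) : 0 < a -> a <= b -> b < 1 / 2 ->
  Phibar_inv b * (Phibar_inv a - Phibar_inv b) <= ln (b / a).
Proof.
move=> a0 ab b2.
have b0 : 0 < b by lra.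
have za := Phibar_invK (p := a) ltac:(lra); have zb := Phibar_invK (p := b) ltac:(lra).
have hb := Phibar_inv_gt0 b0 b2.
have h0 : 0 <= Phibar_inv a - Phibar_inv b.
  by rewrite subr_ge0 -Phibar_le za zb.
have := Phibar_shift (ltW hb) h0; rewrite addrCA subrr addr0 za zb => H.
rewrite -ler_expR lnK ?posrE ?divr_gt0// ler_pdivlMr// mulrC.
apply: (le_trans (ler_wpM2r (expR_ge0 _) H)); rewrite -mulrA -expRD ler_piMr ?(ltW b0)//.
rewrite -[leRHS]expR0 ler_expR.
by have := sqr_ge0 (Phibar_inv a - Phibar_inv b); lra.
Qed.

(** The tail bound [Phibar_expR] read at the quantile of [t], after taking logarithms. *)
Lemma Phibar_inv_sqr t : 0 < t -> t < 1 / 2 ->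
  Phibar_inv t ^+ 2 <= 2 * ln t^-1.
Proof.
move=> t0 t1; have z0 := Phibar_inv_gt0 t0 t1.
have ht := Phibar_invK (p := t) ltac:(lra).
have := Phibar_expR (ltW z0); rewrite ht -ler_ln ?posrE ?expR_gt0// expRK => H.
by rewrite lnV ?posrE//; lra.
Qed.

(* Since [normal_peak 1 = (2 pi)^(-1/2)] is at least 1/3. *)
Lemma Phibar_lower z : 0 <= z -> expR (- z ^+ 2 / 2) <= 24 * (z + 1) * Phibar z.
Proof.
move=> z0; have := phi_le_Phibar z0; rewrite phi0E.
have : 1 / 3 <= normal_peak (1 : R).
  rewrite /normal_peak expr1n !mul1r lef_pV2 ?posrE//; last first.
    by rewrite sqrtr_gt0 pmulrn_lgt0// pi_gt0.
  rewrite -[leRHS]ger0_norm// -sqrtr_sqr ler_wsqrtr//.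
  by have := pihalf_lt2 R; rewrite -mulr_natr; lra.
have := expR_gt0 (- z ^+ 2 / 2); nra.
Qed.

End GaussianTail.

(** * Order statistics and the Benjamini-Hochberg procedure *)

Section OrderStat.
Context {R : realType} {n : nat}.
Implicit Types (y p : 'I_n -> R) (q : nat) (x : R).

Definition count_le y x : nat := #|[set i | y i <= x]%SET|.

(** The interface to sorting: statements on order statistics become statements on counts, the form
    suited to affine maps, measurability and Chebyshev's inequality. *)
Lemma order_stat_le y q x : (0 < q <= n)%N ->
  (order_stat y q <= x) = (q <= count_le y x)%N.
Proof.
case: q => // q /= qn; set s := sort <=%R (codom y).
have ss : sorted <=%R s by apply: sort_sorted => a b; exact: le_total.
have szs : size s = n by rewrite size_sort size_codom card_ord.
have -> : count_le y x = count (<= x) s.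
  rewrite /count_le (permP (permEl (perm_sort _ _))) /codom /image_mem count_map cardE size_filter enumT.
  by apply: eq_count => i; rewrite /= inE.
rewrite /order_stat /= -/s.
case: (ltnP q (count (<= x) s)) => qc; first exact: nth_count_le.
apply/negbTE; rewrite -ltNge; apply: nth_count_gt => //.
by rewrite qc szs.
Qed.

Lemma order_stat_eq y y' q (x : R) : (0 < q <= n)%N ->
  (forall z, (q <= count_le y z)%N = (x <= z)) -> order_stat y q = x.
Proof.
move=> qn H; apply/eqP; rewrite eq_le order_stat_le// H lexx/=.
by rewrite -H -order_stat_le.
Qed.

Lemma order_stat_affine y q (a b : R) : (0 < q <= n)%N -> 0 < b ->
  order_stat (fun i => a + b * y i) q = a + b * order_stat y q.
Proof.
move=> qn b0; apply: order_stat_eq => // z.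
rewrite addrC -lerBrDr mulrC -ler_pdivlMr// order_stat_le//; congr (_ <= _)%N.
by apply: eq_card => i; rewrite !inE addrC -lerBrDr mulrC -ler_pdivlMr.
Qed.

Lemma order_stat_mono y q q' : (0 < q')%N -> (q' <= q <= n)%N ->
  order_stat y q' <= order_stat y q.
Proof.
move=> q'0 /andP[q'q qn]; rewrite order_stat_le ?q'0 ?(leq_trans q'q)//.
have := lexx (order_stat y q).
by rewrite {1}order_stat_le// (leq_trans q'0).
Qed.

(** Coordinate [i] lies strictly above the [q]-th smallest value, so the coordinates at or below
    this value, at least [q] in number, all differ from [i] and survive any change of [y i]. *)
Lemma order_stat_off y y' q (i : 'I_n) : (0 < q <= n)%N ->
  (forall j, j != i -> y j = y' j) -> order_stat y q < y i ->
  order_stat y' q <= order_stat y q.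
Proof.
move=> qn yy' yi; rewrite order_stat_le//.
have := lexx (order_stat y q); rewrite {1}order_stat_le// => /leq_trans; apply.
apply/subset_leq_card/fintype.subsetP => j; rewrite !inE => yj.
by rewrite -yy'//; apply: contraTneq yj => ->; rewrite -ltNge.
Qed.

(* Any value above all the other coordinates would do: this one is measurable. *)
Definition outlier (i : 'I_n) y : 'I_n -> R :=
  fun j => if j == i then 1 + \sum_(k | k != i) `|y k| else y j.

Lemma order_stat_outlier y q (i : 'I_n) : (0 < q < n)%N -> order_stat y q < y i ->
  order_stat (outlier i y) q = order_stat y q.
Proof.
move=> /andP[q0 qn] yi; have qn' : (0 < q <= n)%N by rewrite q0 ltnW.
have off j : j != i -> y j = outlier i y j by rewrite /outlier => /negbTE ->.
apply/eqP; rewrite eq_le (order_stat_off (i := i))//=.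
apply: (order_stat_off (i := i)) => //; first by move=> j /off ->.
(* For the converse direction of [order_stat_off]: as [q < n], the [n - 1] coordinates other than
   [i] suffice to keep the [q]-th smallest below the outlier. *)
apply: (@le_lt_trans _ _ (\sum_(k | k != i) `|y k|)); last first.
  by rewrite /outlier eqxx ltrDr.
rewrite order_stat_le//; apply: (@leq_trans #|[set~ i]%SET|).
  by rewrite cardsC1 card_ord -ltnS (ltn_predK qn).
apply/subset_leq_card/fintype.subsetP => j; rewrite !inE => ji.
rewrite -off// (bigD1 j)//= (le_trans (ler_norm _))// lerDl.
by apply: sumr_ge0.
Qed.

End OrderStat.

(** * Self-consistency of the Benjamini-Hochberg index *)

Section BenjaminiHochberg.
Context {R : realType} {n : nat}.
Implicit Types (y p : 'I_n -> R) (alpha : R).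

Lemma bigmax_nat_attained (P : pred nat) : P 0%N ->
  let L := (\max_(l < n.+1 | P l) l)%N in
  [/\ P L, (L <= n)%N & forall l, (l <= n)%N -> P l -> (l <= L)%N].
Proof.
move=> P0 L; split.
- rewrite /L; have [|l Pl ->//] := @eq_bigmax_cond 'I_n.+1 (fun l => P l) (fun l => l : nat).
  by apply/card_gt0P; exists ord0.
- by apply/bigmax_leqP => l _; rewrite -ltnS.
- move=> l ln Pl; rewrite -ltnS in ln.
  exact: (@leq_bigmax_cond _ (fun l : 'I_n.+1 => P l) (fun l => l : nat) (Ordinal ln)).
Qed.

Definition BH_count alpha p (l : nat) : nat := count_le p (alpha * l%:R / n%:R).

Lemma BH_ellE alpha p : BH_ell alpha p = (\max_(l < n.+1 | l <= BH_count alpha p l) l)%N.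
Proof.
apply: eq_bigl => -[[|l] ln]; first by rewrite /order_stat /= mulr0 mul0r lexx.
by rewrite order_stat_le.
Qed.

Lemma BH_ellP alpha p :
  [/\ (BH_ell alpha p <= BH_count alpha p (BH_ell alpha p))%N, (BH_ell alpha p <= n)%N &
   forall l, (l <= n)%N -> (l <= BH_count alpha p l)%N -> (l <= BH_ell alpha p)%N].
Proof. rewrite BH_ellE; exact: (@bigmax_nat_attained (fun l => l <= BH_count alpha p l)%N). Qed.

Lemma BH_count_mono alpha p l l' : 0 <= alpha -> (l <= l')%N ->
  (BH_count alpha p l <= BH_count alpha p l')%N.
Proof.
move=> a0 ll'; apply/subset_leq_card/fintype.subsetP => i; rewrite !inE => /le_trans; apply.
by rewrite ler_wpM2r ?invr_ge0// ler_wpM2l// ler_nat.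
Qed.

(** By monotonicity the count at the BH index is itself a feasible index, so maximality gives the
    missing inequality. Hence the index is the number of rejections. *)
Lemma BH_count_ell alpha p : 0 <= alpha ->
  BH_count alpha p (BH_ell alpha p) = BH_ell alpha p.
Proof.
move=> a0; have [h1 h2 h3] := BH_ellP alpha p.
apply/eqP; rewrite eqn_leq h1 andbT; apply: h3; first by rewrite -[X in (_ <= X)%N](card_ord n) max_card.
exact: BH_count_mono.
Qed.

Lemma card_BH alpha y u s : 0 <= alpha ->
  #|BH alpha y u s| = BH_ell alpha (pvalue y u s).
Proof. by move=> a0; rewrite -[RHS]BH_count_ell. Qed.

(* The number of rejections if the [i]-th p-value were [0]. *)
Definition BH_ell_out alpha p (i : 'I_n) : nat :=
  (\max_(l < n.+1 | l <= #|i |: [set j | (p j <= alpha * l%:R / n%:R)%R]|) l)%N.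

(** Counting [i] for free can only raise the index, and at the raised index the p-value of the
    rejected [i] already passes, so that index was feasible before. *)
Lemma BH_ell_outE alpha p i : 0 <= alpha -> p i <= alpha * (BH_ell alpha p)%:R / n%:R ->
  BH_ell_out alpha p i = BH_ell alpha p.
Proof.
move=> a0 pi; have [h1 h2 h3] := BH_ellP alpha p.
have [g1 g2 g3] := @bigmax_nat_attained
  (fun l => l <= #|i |: [set j | (p j <= alpha * l%:R / n%:R)%R]|)%N isT.
rewrite -/(BH_ell_out alpha p i) in g1 g2 g3.
have le1 : (BH_ell alpha p <= BH_ell_out alpha p i)%N.
  apply: g3 => //; apply: (leq_trans h1).
  by apply/subset_leq_card/fintype.subsetP => j; rewrite !inE => ->; rewrite orbT.
apply/eqP; rewrite eqn_leq le1 andbT; apply: h3 => //; apply: (leq_trans g1).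
apply/subset_leq_card/fintype.subsetP => j; rewrite !inE => /orP[/eqP ->|//].
by apply: (le_trans pi); rewrite ler_wpM2r ?invr_ge0// ler_wpM2l// ler_nat.
Qed.

Lemma BH_ell_out_eq alpha p p' i : (forall j, j != i -> p j = p' j) ->
  BH_ell_out alpha p i = BH_ell_out alpha p' i.
Proof.
move=> pp'; apply: eq_bigl => l; congr (_ <= _)%N; apply: eq_card => j.
by rewrite !inE; case: eqVneq => //= /pp' ->.
Qed.

(** The number of rejections of the first procedure is a feasible index for the second, whose own
    index, and thus threshold, is at least as large. *)
Lemma BH_subset alpha alpha' y u s u' s' : 0 <= alpha -> 0 <= alpha' ->
  (forall i, i \in BH alpha y u s ->
     pvalue y u' s' i <= alpha' * (BH_ell alpha (pvalue y u s))%:R / n%:R) ->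
  (BH alpha y u s \subset BH alpha' y u' s')%SET.
Proof.
move=> a0 a'0 H; have [h1 h2 h3] := BH_ellP alpha' (pvalue y u' s').
have hl : (BH_ell alpha (pvalue y u s) <= BH_ell alpha' (pvalue y u' s'))%N.
  apply: h3; first by have [_ ? _] := BH_ellP alpha (pvalue y u s).
  rewrite -(card_BH y u s a0); apply/subset_leq_card/fintype.subsetP => i /H.
  by rewrite inE card_BH.
apply/fintype.subsetP => i /H hi; rewrite inE; apply: (le_trans hi).
by rewrite ler_wpM2r ?invr_ge0// ler_wpM2l// ler_nat.
Qed.

Lemma FDP_sum (pi : 'I_n -> probability (measurableTypeR R) R) (S : {set 'I_n}) :
  FDP pi S = \sum_(i in H0 pi) (i \in S)%:R / (maxn #|S| 1)%:R.
Proof.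
rewrite /FDP -mulr_suml; congr (_ / _); rewrite -natr_sum; congr (_%:R).
rewrite -sum1_card big_mkcond [RHS]big_mkcond; apply: eq_bigr => i _.
rewrite inE andbC; case: (i \in H0 pi) => //=; by case: (i \in S).
Qed.

End BenjaminiHochberg.

(** * Measurability and independence *)

Section Measurability.
Context {R : realType}.

(** Inversion takes the value 0 at 0 and is not continuous there, so the origin is treated apart. *)
Lemma measurable_inv : measurable_fun [set: R] (fun x : R => x^-1).
Proof.
have c0 : closed [set (0 : R)] by exact: (accessible_closed_set1 (hausdorff_accessible (@norm_hausdorff _ R))).
have := @measurable_funU _ _ (measurableTypeR R) (measurableTypeR R) [set 0] (~` [set 0])
  (fun x : R => x^-1).
rewrite setUv => -[].
  exact: measurable_set1.
  apply: measurableC; exact: measurable_set1.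
move=> _; apply; split; first exact: measurable_fun_set1.
apply: open_continuous_measurable_fun; first exact: closed_openC.
move=> x; rewrite inE /= => /eqP x0; exact: inv_continuous.
Qed.
Context d (T : measurableType d).

(** A quantity determined by finitely many measurable bits has level sets that are finite unions of
    finite intersections of measurable sets. The type [V] is arbitrary, so this applies to
    set-valued procedures. *)
Lemma measurable_bits (F : finType) (b : F -> T -> bool) V (psi : {ffun F -> bool} -> V)
    (A : set V) : (forall f, measurable [set w | b f w]) ->
  measurable [set w | A (psi [ffun f => b f w])].
Proof.
move=> mb.
rewrite (_ : [set w | _] = \bigcup_(g in [set g : {ffun F -> bool} | A (psi g)])
   \bigcap_(f in [set: F]) [set w | b f w = g f]).
  apply: fin_bigcup_measurable => [|g _]; first exact: finite_finset.
  apply: fin_bigcap_measurable => [|f _]; first exact: finite_finset.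
  case: (g f); first exact: mb.
  rewrite (_ : [set w | _] = ~` [set w | b f w]); first exact: measurableC.
  by apply/seteqP; split => w /=; [move=> ->|move=> /negP/negbTE].
apply/seteqP; split => w /=.
  by move=> h; exists [ffun f => b f w] => // f _ /=; rewrite ffunE.
move=> [g /= Ag gb]; rewrite (_ : [ffun f => _] = g)//.
by apply/ffunP => f; rewrite ffunE; exact: gb.
Qed.

Section Statistics.
Context {n : nat}.
Variable y : 'I_n -> T -> R.
Hypothesis my : forall i, measurable_fun setT (y i).
Let Y w := fun i => y i w.

Lemma measurable_le (f g : T -> R) : measurable_fun setT f -> measurable_fun setT g ->
  measurable [set w | f w <= g w].
Proof.
move=> mf mg; have mb : measurable [set true] by [].
by have := measurable_fun_ler mf mg measurableT mb; rewrite setTI.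
Qed.

Lemma measurable_lt (f g : T -> R) : measurable_fun setT f -> measurable_fun setT g ->
  measurable [set w | f w < g w].
Proof.
move=> mf mg; have mb : measurable [set true] by [].
by have := measurable_fun_ltr mf mg measurableT mb; rewrite setTI.
Qed.

Lemma measurable_order_stat q : measurable_fun setT (fun w => order_stat (Y w) q).
Proof.
case: (boolP (0 < q <= n)%N) => [qn|].
  apply: (measurability _ (RGenOInfty.measurableE R)) => _ [_ [x ->] <-]; rewrite setTI.
  rewrite (_ : _ @^-1` _ = ~` [set w | order_stat (Y w) q <= x]); last first.
    by apply/seteqP; split => w /=; rewrite in_itv/= andbT ltNge => /negP.
  apply: measurableC.
  have := @measurable_bits _ (fun i w => y i w <= x) bool
    (fun g => (q <= #|[set i | g i]%SET|)%N) is_true.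
  set A := [set w | _]; set B := [set w | _]; suff -> : A = B.
    by apply => i; apply: measurable_le.
  apply/seteqP; split => w; rewrite /A /B /= order_stat_le// /count_le;
   by congr (is_true (_ <= _)%N); apply: eq_card => i; rewrite !inE ffunE.
move=> qn; rewrite (_ : (fun w => _) = cst 0) ?measurable_cst//.
apply/funext => w; rewrite /order_stat; case: q qn => //= q qn.
rewrite nth_default// size_sort size_codom card_ord.
by move: qn; rewrite -leqNgt.
Qed.

Lemma measurable_sigma_plus k0 : measurable_fun setT (fun w => sigma_plus k0 (Y w)).
Proof.
apply: measurable_funM => //; apply: measurable_funB; exact: measurable_order_stat.
Qed.

Lemma measurable_theta_plus k0 : measurable_fun setT (fun w => theta_plus k0 (Y w)).
Proof.
apply: measurable_funD; first exact: measurable_order_stat.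
by apply: measurable_funM => //; exact: measurable_sigma_plus.
Qed.

Lemma measurable_Phibar : measurable_fun [set: R] (Phibar : R -> R).
Proof. by apply: nonincreasing_measurable => // a b; exact: Phibar_noninc. Qed.

Variables u s : T -> R.
Hypotheses (mu : measurable_fun setT u) (ms : measurable_fun setT s).

Lemma measurable_pvalue i : measurable_fun setT (fun w => pvalue (Y w) (u w) (s w) i).
Proof.
apply: (measurableT_comp measurable_Phibar); apply: measurable_funM.
  by apply: measurable_funB => //; exact: my.
exact: (measurableT_comp measurable_inv).
Qed.

Lemma measurable_BH alpha V (psi : {set 'I_n} -> V) (A : set V) :
  measurable [set w | A (psi (BH alpha (Y w) (u w) (s w)))].
Proof.
(* The rejection set is a function of all comparisons of a p-value with one of the [n + 1] levels
   [alpha * l / n]. *)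
pose b (f : 'I_n.+1 * 'I_n) w :=
  pvalue (Y w) (u w) (s w) f.2 <= alpha * f.1%:R / n%:R.
pose L (g : {ffun 'I_n.+1 * 'I_n -> bool}) : nat :=
  (\max_(l < n.+1 | l <= #|[set i | g (l, i)]%SET|) l)%N.
have := @measurable_bits _ b V
  (fun g => psi [set i | g (inord (L g), i)]%SET) A.
set B := [set w | _]; set C := [set w | _]; suff -> : B = C.
  by apply => f; apply: measurable_le => //; exact: measurable_pvalue.
have e w : BH alpha (Y w) (u w) (s w) =
    [set i | [ffun f => b f w] (inord (L [ffun f => b f w]), i)]%SET.
  have -> : L [ffun f => b f w] = BH_ell alpha (pvalue (Y w) (u w) (s w)).
    rewrite BH_ellE; apply: eq_bigl => l; congr (_ <= _)%N; apply: eq_card => i.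
    by rewrite !inE ffunE.
  apply/setP => i; rewrite !inE ffunE /b /= inordK//.
  by have [_ + _] := BH_ellP alpha (pvalue (Y w) (u w) (s w)).
by apply/seteqP; split => w; rewrite /B /C /= e.
Qed.

Lemma measurable_BH_fun alpha (psi : {set 'I_n} -> R) :
  measurable_fun setT (fun w => psi (BH alpha (Y w) (u w) (s w))).
Proof. by move=> _ A mA; rewrite setTI; exact: (measurable_BH _ psi A). Qed.

Lemma measurable_BH_ell_out alpha i k :
  measurable [set w | BH_ell_out alpha (pvalue (Y w) (u w) (s w)) i = k].
Proof.
pose b (f : 'I_n.+1 * 'I_n) w :=
  pvalue (Y w) (u w) (s w) f.2 <= alpha * f.1%:R / n%:R.
have := @measurable_bits _ b nat
  (fun g => \max_(l < n.+1 | l <= #|(i |: [set j | g (l, j)])%SET|) l)%N [set k].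
set B := [set w | _]; set C := [set w | _]; suff -> : B = C.
  by apply => f; apply: measurable_le => //; exact: measurable_pvalue.
suff e w : BH_ell_out alpha (pvalue (Y w) (u w) (s w)) i =
  (\max_(l < n.+1 | l <= #|(i |: [set j | [ffun f => b f w] (l, j)])%SET|) l)%N.
  by apply/seteqP; split => w; rewrite /B /C /= e.
apply: eq_bigl => l; congr (_ <= _)%N; apply: eq_card => j.
by rewrite !inE ffunE.
Qed.

End Statistics.

Lemma measurable_outlier n (y : 'I_n -> T -> R) i j :
  (forall k, k != i -> measurable_fun setT (y k)) ->
  measurable_fun setT (fun w => outlier i (y^~ w) j).
Proof.
move=> my; rewrite /outlier; case: (eqVneq j i) => ji; last exact: my.
apply: measurable_funD => //.
under eq_fun do rewrite big_mkcond; apply: measurable_sum => k.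
by case: (boolP (k != i)) => // ki; apply: measurableT_comp => //; exact: my.
Qed.

End Measurability.

Section Independence.
Context {R : realType} {n : nat} d (T : measurableType d) (P : probability T R).
Variables (eps : 'I_n -> {RV P >-> measurableTypeR R}).
Hypothesis ind : mutually_independent eps.

(** A family stable under intersection that generates the sigma-algebra of the coordinates other
    than [i]. *)
Definition rest_cylinders (i : 'I_n) : set (set T) :=
  [set A | exists2 B : 'I_n -> set (measurableTypeR R), (forall j, measurable (B j)) &
     A = \bigcap_(j in [set` [set~ i]%SET]) (eps j @^-1` B j)].

(** Uniqueness of measures: intersecting with the event on [eps i], or multiplying by its
    probability, gives two finite measures that agree on the cylinders by mutual independence. *)
Lemma indep_rest i (A : set T) (B : set (measurableTypeR R)) : measurable B ->
  <<s rest_cylinders i >> A ->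
  P (A `&` eps i @^-1` B) = (P A * P (eps i @^-1` B))%E.
Proof.
move=> mB sA.
have mE : measurable (eps i @^-1` B) by rewrite -[_ @^-1` _]setTI; exact: measurable_funPT.
pose r : {nonneg R} := NngNum (fine_ge0 (measure_ge0 P (eps i @^-1` B))).
have rE : r%:num%:E = P (eps i @^-1` B) by rewrite /= fineK// fin_num_measure.
rewrite muleC -rE -[LHS]/(mrestr P mE A) -[RHS]/(mscale r P A).
apply: (@g_sigma_algebra_measure_unique _ _ _ (rest_cylinders i) _ (fun=> setT)) => //.
- move=> _ [C mC ->]; apply: fin_bigcap_measurable; first exact: finite_finset.
  by move=> j _; rewrite -[_ @^-1` _]setTI; exact: measurable_funPT.
- move=> _; exists (fun=> setT) => //.
  by apply/seteqP; split => w // _ j _.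
- by apply/seteqP; split => w // _; exists 0%N.
- move=> _ _ [C1 m1 ->] [C2 m2 ->]; exists (fun j => C1 j `&` C2 j).
    by move=> j; exact: measurableI.
  apply/seteqP; split => w /=.
    by move=> [h1 h2] j ji; split; [exact: h1|exact: h2].
  by move=> h; split => j ji; have [] := h j ji.
- move=> X [C mC XE]; rewrite [LHS]/= [RHS]/=.
  change (P (X `&` eps i @^-1` B) = (r%:num%:E * P X)%E).
  rewrite rE XE ind//.
  have mBC j : measurable (if j == i then B else C j) by case: ifP.
  have H := @ind [set: 'I_n]%SET _ mBC.
  rewrite (bigD1 i) ?inE// eqxx in H.
  rewrite (_ : _ `&` _ = \bigcap_(j in [set` [set: 'I_n]%SET])
      (eps j @^-1` (if j == i then B else C j))).
    rewrite H; congr (_ * _)%E.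
    apply: eq_big => j; first by rewrite !inE.
    by move=> /andP[_ /negbTE ->].
  apply/seteqP; split => w /=.
    by move=> [h1 h2] j _ /=; case: eqVneq => [->//|ji]; apply: h1; rewrite /= !inE.
  move=> h; split => [j /=|]; rewrite ?inE.
    by move=> ji; have := h j; rewrite /= inE (negbTE ji); apply.
  by have := h i; rewrite /= inE eqxx; apply.
- by move=> _; rewrite [X in (X < _)%E]/(P _) (le_lt_trans (probability_le1 _ _)) ?ltry//; exact: measurableI.
Qed.

Lemma indep_pair i j (B : set (measurableTypeR R)) : i != j -> measurable B ->
  P (eps i @^-1` B `&` eps j @^-1` B) = (P (eps i @^-1` B) * P (eps j @^-1` B))%E.
Proof.
move=> ij mB; have := @ind [set i; j]%SET (fun=> B) (fun=> mB).
rewrite big_setU1 ?inE//= big_set1 => <-; congr (P _).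
apply/seteqP; split => w /=.
  by move=> [h1 h2] k /=; rewrite !inE => /orP[] /eqP ->.
by move=> h; split; apply: h; rewrite /= !inE eqxx ?orbT.
Qed.

End Independence.

(** * Chebyshev's inequality for counts of pairwise independent events *)

Section Chebyshev.
Context {R : realType} d (T : measurableType d) (P : probability T R).
Context {I : finType} (A : I -> set T) (D : {set I}).
Hypothesis mA : forall i, measurable (A i).
Hypothesis indA : forall i j, i != j -> P (A i `&` A j) = (P (A i) * P (A j))%E.

Let N w : R := \sum_(i in D) \1_(A i) w.
Let m : R := \sum_(i in D) fine (P (A i)).

Lemma measurable_count : measurable_fun setT N.
Proof.
rewrite /N; under eq_fun do rewrite big_mkcond; apply: measurable_sum => i.
by case: (i \in D) => //; exact: measurable_indic.
Qed.

Lemma integral_count (c : R) : 0 <= c -> (\int[P]_w (c * N w)%:E = (c * m)%:E)%E.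
Proof.
move=> c0.
rewrite (_ : (fun w => _) = (fun w => \sum_(i <- index_enum I | i \in D) (c * \1_(A i) w)%:E)%E); last first.
  by apply/funext => w; rewrite sumEFin -mulr_sumr.
under eq_integral do rewrite big_mkcond.
rewrite ge0_integral_sum//; last 2 first.
- move=> i; case: (i \in D) => //; apply/measurable_EFinP; apply: measurable_funM => //.
- by move=> i w _; case: ifP => _ //; rewrite lee_fin mulr_ge0.
rewrite /m mulr_sumr -sumEFin [RHS]big_mkcond; apply: eq_bigr => i _.
case: (i \in D); last exact: integral0.
rewrite (_ : (fun w => _) = (fun w => c%:E * (\1_(A i) w)%:E)%E); last first.
  by apply/funext => w; rewrite EFinM.
rewrite ge0_integralZl//; last by apply/measurable_EFinP; exact: measurable_indic.
by rewrite integral_indic// setIT EFinM fineK// fin_num_measure.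
Qed.

(** Expanding the square gives the probabilities of [A i] and [A j] jointly: pairwise independence
    turns the off-diagonal terms into products, contained in [m ^+ 2], and the diagonal adds at most
    [m]. *)
Lemma integral_count_sqr : (\int[P]_w (N w ^+ 2)%:E <= (m ^+ 2 + m)%:E)%E.
Proof.
rewrite (_ : (fun w => _) =
  (fun w => \sum_(i <- index_enum I) \sum_(j <- index_enum I)
     (if (i \in D) && (j \in D) then \1_(A i `&` A j) w else 0)%:E)%E); last first.
  apply/funext => w; rewrite /N expr2 mulr_suml -sumEFin big_mkcond; apply: eq_bigr => i _.
  case: ifP => iD /=; last by rewrite big1.
  rewrite mulr_sumr -sumEFin big_mkcond; apply: eq_bigr => j _.
  by case: ifP => //= jD; rewrite indicI.
have mm i j : measurable_fun setT
    (fun w => (if (i \in D) && (j \in D) then \1_(A i `&` A j) w else 0 : R)).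
  by case: (_ && _) => //; apply: measurable_indic; exact: measurableI.
have ge0 i j w : 0 <= (if (i \in D) && (j \in D) then \1_(A i `&` A j) w else 0 : R).
  by case: ifP.
rewrite ge0_integral_sum//; last 2 first.
- move=> i; apply: emeasurable_sum => j; apply/measurable_EFinP; exact: mm.
- by move=> i w _; apply: sume_ge0 => j _; rewrite lee_fin.
pose p i := fine (P (A i)).
have pE i : P (A i) = (p i)%:E by rewrite fineK// fin_num_measure.
have p0 i : 0 <= p i by exact: fine_ge0.
have mE : m = \sum_i (if i \in D then p i else 0) by rewrite /m big_mkcond.
rewrite [X in (_ <= X%:E)%E](_ : _ = \sum_i \sum_j (if (i \in D) && (j \in D) then p i * p j + (i == j)%:R * p i else 0)).
  rewrite -sumEFin; apply: lee_sum => i _.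
  rewrite ge0_integral_sum//; last 2 first.
  - by move=> j; apply/measurable_EFinP; exact: mm.
  - by move=> j w _; rewrite lee_fin.
  rewrite -sumEFin; apply: lee_sum => j _.
  case: (_ && _); last by rewrite integral0.
  rewrite integral_indic//; last exact: measurableI.
  apply: (@le_trans _ _ (P (A i `&` A j))); first by rewrite setIT lexx.
  case: eqVneq => [<-|ij].
    by rewrite setIid pE lee_fin mul1r lerDr mulr_ge0.
  by rewrite mul0r addr0 indA// !pE.
rewrite expr2 mE mulr_suml -big_split/=; apply: eq_bigr => i _.
case: ifP => iD /=; last by rewrite mul0r add0r big1.
rewrite mulr_sumr [in LHS](bigD1 i)//= [in RHS](bigD1 i)//= iD eqxx mul1r addrAC; congr (_ + _).
apply: eq_bigr => j ji; rewrite eq_sym (negbTE ji) mul0r addr0.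
by case: ifP => //; rewrite mulr0.
Qed.

Lemma chebyshev_count (l : R) : 0 < l ->
  (P [set w | (l <= `|N w - m|)%R] <= (m / l ^+ 2)%:E)%E.
Proof.
move=> l0; have m0 : 0 <= m by apply: sumr_ge0 => i _; exact: fine_ge0.
set E := [set w | _].
have mN := measurable_count.
have mE : measurable E.
  apply: measurable_le => //; apply: measurableT_comp => //; exact: measurable_funB.
have N0 w : 0 <= N w by apply: sumr_ge0.
have msq : measurable_fun setT (fun w => (N w - m) ^+ 2).
  by apply: measurable_funX; exact: measurable_funB.
(* The cross term [2 * m * N] is moved to the left, so that all integrands are nonnegative and
   integrals add up without integrability conditions. This bounds the variance by [m]. *)
have H1 : (\int[P]_w ((N w - m) ^+ 2)%:E + (2 * m * m)%:E <= (m ^+ 2 + m)%:E + (m ^+ 2)%:E)%E.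
  rewrite -integral_count; last by lra.
  rewrite -ge0_integralD//; first last.
  - by apply/measurable_EFinP; exact: measurable_funM.
  - by move=> w _; rewrite lee_fin !mulr_ge0.
  - exact/measurable_EFinP.
  - by move=> w _; rewrite lee_fin sqr_ge0.
  rewrite (_ : (fun w => _) = (fun w => (N w ^+ 2)%:E + (m ^+ 2)%:E)%E); last first.
    by apply/funext => w; rewrite -!EFinD; congr (_%:E); ring.
  rewrite ge0_integralD//; first last.
  - by move=> w _; rewrite lee_fin sqr_ge0.
  - by apply/measurable_EFinP; exact: measurable_funX.
  - by move=> w _; rewrite lee_fin sqr_ge0.
  rewrite integral_cst//= probability_setT mule1; apply: leeD => //; exact: integral_count_sqr.
have H2 : ((l ^+ 2)%:E * P E <= \int[P]_w ((N w - m) ^+ 2)%:E)%E.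
  rewrite -[E]setIT -integral_indic// -ge0_integralZl//; first last.
  - by rewrite lee_fin sqr_ge0.
  - by apply/measurable_EFinP; exact: measurable_indic.
  apply: ge0_le_integral => //.
  - by move=> w _; rewrite -EFinM lee_fin mulr_ge0 ?sqr_ge0.
  - by apply: measurable_funeM; apply/measurable_EFinP; exact: measurable_indic.
  - exact/measurable_EFinP.
  move=> w _; rewrite -EFinM lee_fin indicE; case: (boolP (w \in E)) => wE.
    rewrite mulr1 -[leRHS]ger0_norm ?sqr_ge0// normrX lerXn2r ?nnegrE ?normr_ge0 ?(ltW l0)//.
    by rewrite inE in wE.
  by rewrite mulr0 sqr_ge0.
have fP : P E = (fine (P E))%:E by rewrite fineK// fin_num_measure.
have : ((l ^+ 2)%:E * P E + (2 * m * m)%:E <= (m ^+ 2 + m)%:E + (m ^+ 2)%:E)%E.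
  by apply: le_trans H1; rewrite leeD2r.
rewrite fP -EFinM -!EFinD !lee_fin => H.
rewrite ler_pdivlMr ?exprn_gt0//; nra.
Qed.

End Chebyshev.

(** * Deviations of order statistics under the model *)

Section Noise.
Context {R : realType} {n : nat} d (T : measurableType d) (P : probability T R).
Variables (pi : 'I_n -> probability (measurableTypeR R) R).
Variables (eps : 'I_n -> {RV P >-> measurableTypeR R}).
Hypothesis noise : OSC_noise pi eps.
Hypothesis dom : forall i, dominates_normal (pi i).

Lemma noise_prob i (B : set (measurableTypeR R)) : measurable B ->
  P (eps i @^-1` B) = pi i B.
Proof. by move=> mB; have [_ /(_ i B mB)] := noise. Qed.

Lemma measurable_noise i (B : set (measurableTypeR R)) : measurable B ->
  measurable (eps i @^-1` B).
Proof. by move=> mB; rewrite -[_ @^-1` _]setTI; exact: measurable_funPT. Qed.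

Lemma noise_le i z : fine (P (eps i @^-1` `]-oo, - z]%classic)) <= Phibar z.
Proof.
have := dom i (- z); rewrite Phibar_cdf PhibarN opprB addrCA subrr addr0.
rewrite noise_prob// -[X in (X <= _)%E -> _]fineK ?fin_num_measure//.
Qed.

(** A strict inequality at a single point would put the dominating [pi i] into [H1], so outside [H1]
    the two c.d.f.s coincide. *)
Lemma noise_notin_H1 i z : i \notin H1 pi ->
  fine (P (eps i @^-1` `]-oo, - z]%classic)) = Phibar z.
Proof.
move=> iH; apply/eqP; rewrite eq_le noise_le /= leNgt; apply/negP => lt.
move/negP: iH; apply; rewrite inE; apply/asboolP; split; first exact: dom.
exists (- z); rewrite Phibar_cdf PhibarN opprB addrCA subrr addr0.
by move: lt; rewrite noise_prob// -[X in _ -> (X < _)%E]fineK ?fin_num_measure.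
Qed.

Lemma noise_H0 i x : i \in H0 pi -> P (eps i @^-1` `]x, +oo[%classic) = (Phibar x)%:E.
Proof.
rewrite inE => /asboolP H; rewrite noise_prob// PhibarE; exact: H.
Qed.

Let E w i := eps i w.

Let A z i : set T := eps i @^-1` `]-oo, - z]%classic.

Let mA z i : measurable (A z i).
Proof. exact: measurable_noise. Qed.

Let indA z i j : i != j -> P (A z i `&` A z j) = (P (A z i) * P (A z j))%E.
Proof. by have [ind _] := noise; move=> ij; exact: indep_pair. Qed.

Lemma count_le_indic w z (D : {set 'I_n}) :
  \sum_(i in D) \1_(A z i) w = #|D :&: [set i | E w i <= - z]|%:R :> R.
Proof.
rewrite -sum1_card natr_sum big_mkcond [RHS]big_mkcond; apply: eq_bigr => i _.
rewrite !inE indicE (_ : (w \in A z i) = (E w i <= - z)); last first.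
  by apply/idP/idP; rewrite inE /A /= in_itv.
by case: (i \in D) => //=; case: ifP.
Qed.

Lemma measurable_eps i : measurable_fun setT (eps i : T -> R).
Proof. exact: (measurable_funPT (eps i)). Qed.

Lemma measurable_order_stat_le q z : measurable [set w | order_stat (E w) q <= z].
Proof.
by apply: measurable_le => //; apply: measurable_order_stat => i; exact: measurable_eps.
Qed.

Let m z (D : {set 'I_n}) : R := \sum_(i in D) fine (P (A z i)).

Let Ch z D := @chebyshev_count R _ _ P 'I_n (A z) D (mA z) (@indA z).

Let measurable_count_dev z (D : {set 'I_n}) (l : R) :
  measurable [set w | l <= `|\sum_(i in D) \1_(A z i) w - m z D|].
Proof.
apply: measurable_le => //; apply: measurableT_comp => //; apply: measurable_funB => //.
exact: measurable_count.
Qed.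

(** The count of noises at or below [- z] has mean at most [q * (1 - r)], contamination only
    lowering it; the event forces this count up to [q], a deviation of at least [q * r]. *)
Lemma order_stat_dev_lower q (r z : R) : (0 < q <= n)%N -> 0 < r ->
  n%:R * Phibar z <= q%:R * (1 - r) ->
  (P [set w | (order_stat (E w) q <= - z)%R] <= (1 / (q%:R * r ^+ 2))%:E)%E.
Proof.
move=> qn r0 H; have q0 : 0 < q%:R :> R by rewrite ltr0n; case/andP: qn.
have m0 : 0 <= m z [set: 'I_n] by apply: sumr_ge0 => i _; exact: fine_ge0.
have mle : m z [set: 'I_n] <= q%:R * (1 - r).
  apply: le_trans H; rewrite -[X in X%:R * _](card_ord n) -cardsT mulr_natl -sumr_const.
  by apply: ler_sum => i _; exact: noise_le.
have qr0 := mulr_gt0 q0 r0.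
apply: (@le_trans _ _ (m z [set: 'I_n] / (q%:R * r) ^+ 2)%:E); last first.
  rewrite lee_fin ler_pdivrMr ?exprn_gt0// mul1r exprMn mulrC expr2 -mulrA mulrK; last first.
    by rewrite unitfE mulf_neq0// ?expf_neq0// gt_eqF.
  by apply: (le_trans mle); rewrite ler_piMr ?ltW//; lra.
apply: le_trans (@Ch z _ _ qr0); apply: le_measure.
- by rewrite inE; exact: measurable_order_stat_le.
- by rewrite inE; exact: measurable_count_dev.
move=> w /=; rewrite order_stat_le// /count_le count_le_indic finset.setTI => qc.
have : q%:R <= #|[set i | E w i <= - z]%SET|%:R :> R by rewrite ler_nat.
by move=> h; rewrite ler_normr; apply/orP; left; rewrite -/(m z _); lra.
Qed.

(** Only coordinates outside [H1] are counted, as their probabilities are known exactly; the event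
    forces their count below [q], hence well below its mean. *)
Lemma order_stat_dev_upper q (r z : R) : (0 < q <= n)%N -> 0 < r <= 1 ->
  q%:R * (1 + r) <= (n%:R - (n1 pi)%:R) * Phibar z ->
  (P [set w | (- z < order_stat (E w) q)%R] <= (2 / (q%:R * r ^+ 2))%:E)%E.
Proof.
move=> qn /andP[r0 r1] H; have q0 : 0 < q%:R :> R by rewrite ltr0n; case/andP: qn.
set D := ~: H1 pi.
have mE : m z D = (n%:R - (n1 pi)%:R) * Phibar z.
  rewrite /m (eq_bigr (fun=> Phibar z)); last first.
    by move=> i; rewrite inE; exact: noise_notin_H1.
  have : (#|H1 pi| + #|D| = n)%N by rewrite cardsC card_ord.
  move=> /(congr1 (fun k => k%:R : R)); rewrite natrD => nE.
  rewrite sumr_const -[LHS]mulr_natl; congr (_ * _); apply/eqP.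
  by rewrite eq_sym subr_eq addrC nE.
rewrite -mE in H.
have m0 : 0 < m z D by apply: lt_le_trans H; rewrite mulr_gt0//; lra.
(* The deviation is taken proportional to the mean: Chebyshev's bound then decreases in the mean,
   for which only the lower bound [q * (1 + r)] is available. *)
have l0 : 0 < m z D * (r / (1 + r)) by rewrite mulr_gt0// divr_gt0//; lra.
have d0 : 0 < q%:R * r ^+ 2 by rewrite mulr_gt0 ?exprn_gt0.
apply: (@le_trans _ _ (m z D / (m z D * (r / (1 + r))) ^+ 2)%:E); last first.
  have -> : m z D / (m z D * (r / (1 + r))) ^+ 2 = (1 + r) ^+ 2 / (m z D * r ^+ 2).
    by field; rewrite !gt_eqF//; lra.
  rewrite lee_fin ler_pdivrMr ?mulr_gt0 ?exprn_gt0// mulrAC ler_pdivlMr//.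
  rewrite mulrA [leRHS]mulrA ler_pM2r ?exprn_gt0//.
  have h1 : (1 + r) * (q%:R * (1 + r)) <= (1 + r) * m z D by rewrite ler_wpM2l//; lra.
  have h2 : (1 + r) * m z D <= 2 * m z D by rewrite ler_pM2r//; lra.
  lra.
apply: le_trans (@Ch z _ _ l0); apply: le_measure.
- rewrite inE; rewrite (_ : [set w | _] = ~` [set w | order_stat (E w) q <= - z]).
    by apply: measurableC; exact: measurable_order_stat_le.
  by apply/seteqP; split => w /=; rewrite ltNge => /negP.
- by rewrite inE; exact: measurable_count_dev.
move=> w /=; rewrite ltNge order_stat_le// /count_le -ltnNge count_le_indic => qc.
have : #|D :&: [set i | E w i <= - z]%SET|%:R <= q%:R :> R.
  by rewrite ler_nat (leq_trans _ (ltnW qc))// subset_leq_card// subsetIr.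
move=> h; rewrite ler_normr; apply/orP; right; rewrite -/(m z _).
have -> : m z D * (r / (1 + r)) = m z D - m z D / (1 + r) by field; lra.
suff : q%:R <= m z D / (1 + r) by lra.
by rewrite ler_pdivlMr//; lra.
Qed.

End Noise.

(** * Levels and quantiles for large n *)

Section Rate.
Context {R : realType} (n : nat).

(* With [s = sqrt_ln], [n = expR (s ^+ 2)]: all powers of [n] become exponentials,
   in particular [rate] is [n^(-1/16)]. *)
Definition sqrt_ln : R := Num.sqrt (ln n%:R).
Definition rate : R := expR (- (sqrt_ln ^+ 2 / 16)).

End Rate.

Section Asymptotics.
Context {R : realType} (n : nat).
Local Notation z := (@Phibar_inv R).
Local Notation s := (@sqrt_ln R n).
Local Notation r := (@rate R n).
Hypothesis n0 : (0 < n)%N.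
Hypothesis hs : 40 * 50 <= s.

Lemma n_expR : n%:R = expR (s ^+ 2).
Proof.
rewrite /sqrt_ln sqr_sqrtr ?lnK ?posrE ?ltr0n// ln_ge0// ler1n//.
Qed.

Lemma powR_expR a : n%:R `^ a = expR (a * s ^+ 2).
Proof.
by rewrite /powR n_expR expRK gt_eqF ?expR_gt0.
Qed.

Lemma r_small : 0 < r /\ r * s ^+ 2 <= 16.
Proof.
rewrite /rate expR_gt0; split => //.
have := @expR_ge1Dx R (s ^+ 2 / 16).
rewrite expRN => h; rewrite mulrC ler_pdivrMr ?expR_gt0//; lra.
Qed.

Let ss : 40 * 50 * s <= s ^+ 2 /\ 40 * 50 <= s ^+ 2.
Proof.
move: hs => hs'; have h : 40 * 50 * s <= s ^+ 2 by rewrite expr2 ler_wpM2r//; lra.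
by split=> //; apply: le_trans h; lra.
Qed.

Lemma r_le : r <= 1 / (20 * 50).
Proof.
have [r0 h] := r_small; have [h1 _] := ss; move: hs => hs'.
have : r * (40 * 50 * s) <= r * s ^+ 2 by rewrite ler_wpM2l// ltW.
have : r * (40 * 50) <= r * s by rewrite ler_wpM2l// ltW.
lra.
Qed.

(** [n^(-1/4)] and [n^(-3/4)], the orders of the levels [qn / n] and [qn' / n]. *)
Let b1 : R := expR (- (1 / 4 * s ^+ 2)).
Let b3 : R := expR (- (3 / 4 * s ^+ 2)).

(** Inverts the lower tail bound [Phibar_lower]. The slack 20 in the level absorbs the factor 10
    between [n - k0] and [n] and the perturbations [1 + r]. *)
Lemma Phibar_inv_large (c u t : R) : 0 <= u -> 0 < t -> t < 1 ->
  20 * 24 * (u + 1) <= expR (c - u ^+ 2 / 2) -> t <= 20 * expR (- c) -> u <= z t.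
Proof.
move=> u0 t0 t1 hu ht; rewrite Phibar_inv_ge; last by rewrite t0.
have := Phibar_lower u0 => H.
apply: (le_trans ht); rewrite -(@ler_pM2l _ (24 * (u + 1))); last by lra.
apply: le_trans H.
rewrite (_ : - u ^+ 2 / 2 = (c - u ^+ 2 / 2) + - c); last by field.
rewrite expRD !mulrA ler_pM2r ?expR_gt0//; lra.
Qed.

Lemma expRN_small (a : R) : 1 / 10 <= a -> 0 < expR (- (a * s ^+ 2)) <= 1 / 100.
Proof.
move=> ha; rewrite expR_gt0 andTb expRN; have := @expR_ge1Dx R (a * s ^+ 2) => h.
have [_ h2] := ss; have h3 : 1 / 10 * s ^+ 2 <= a * s ^+ 2 by rewrite ler_wpM2r ?sqr_ge0.
by rewrite div1r lef_pV2 ?posrE ?expR_gt0//; lra.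
Qed.

Lemma b_small : [/\ 0 < b1, 0 < b3, b1 <= 1 / 100 & b3 <= 1 / 100].
Proof.
have /andP[h1 h2] := @expRN_small (1 / 4) ltac:(lra).
by have /andP[h3 h4] := @expRN_small (3 / 4) ltac:(lra).
Qed.

Lemma Phibar_inv_b3 t : 0 < t -> t <= 20 * b3 -> s <= z t.
Proof.
move: hs => hs' t0 ht; have s0 : 0 <= s by lra.
apply: (@Phibar_inv_large (3 / 4 * s ^+ 2)) => //; try lra.
  by have [] := b_small; lra.
have [h1 h2] := ss; have := @expR_ge1Dx R (s ^+ 2 / 4); rewrite (_ : 3 / 4 * s ^+ 2 - _ = s ^+ 2 / 4); last by field.
lra.
Qed.

Lemma Phibar_inv_b1 t : 0 < t -> t <= 20 * b1 -> s / 2 <= z t.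
Proof.
move: hs => hs' t0 ht; have s0 : 0 <= s by lra.
apply: (@Phibar_inv_large (1 / 4 * s ^+ 2)) => //; try lra.
  by have [] := b_small; lra.
have [h1 h2] := ss; have := @expR_ge1Dx R (s ^+ 2 / 8); rewrite (_ : 1 / 4 * s ^+ 2 - _ = s ^+ 2 / 8); last by field.
lra.
Qed.

(** The squared quantile is at most [s ^+ 2 / 2 + 2]. The factor [3 / 4] stays below the lower bound
    [s] of the other quantile, so the two are separated by order [s]. *)
Lemma Phibar_inv_ub1 t : t < 1 / 2 -> b1 / 2 <= t -> z t <= 3 / 4 * s.
Proof.
move=> t2 ht; have b0 : 0 < b1 by exact: expR_gt0.
have t0 : 0 < t by lra.
have := Phibar_inv_sqr t0 t2; have := Phibar_inv_gt0 t0 t2.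
have : ln t^-1 <= 1 / 4 * s ^+ 2 + 1.
  rewrite -[leRHS]expRK ler_ln ?posrE ?invr_gt0 ?expR_gt0//.
  rewrite invf_ple ?posrE ?expR_gt0// -expRN opprD expRD -/b1.
  apply: le_trans ht; rewrite ler_pM2l//.
  have := @expR_ge1Dx R 1; rewrite expRN => h.
  by rewrite lef_pV2 ?posrE ?expR_gt0//; lra.
move: hs => hs' h1 h2 h3; have [_ h4] := ss.
by rewrite -(@ler_pXn2r _ 2) ?nnegrE ?(ltW h2)//; [rewrite exprMn; lra|lra].
Qed.

Lemma truncn_half (x : R) : 1 <= x -> x / 2 <= (Num.truncn x)%:R <= x.
Proof.
move=> x1; have /truncn_itv : 0 <= x by lra.
have : 1 <= (Num.truncn x)%:R :> R by rewrite ler1n truncn_gt0.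
rewrite -natr1; lra.
Qed.

Lemma qn_bounds : b3^-1 / 2 <= (@qn R n)%:R <= b3^-1.
Proof.
rewrite /b3 expRN invrK /qn powR_expR; apply: truncn_half.
by rewrite -[leLHS]expR0 ler_expR mulr_ge0 ?sqr_ge0.
Qed.

Lemma qn'_bounds : b1^-1 / 2 <= (@qn' R n)%:R <= b1^-1.
Proof.
rewrite /b1 expRN invrK /qn' powR_expR; apply: truncn_half.
by rewrite -[leLHS]expR0 ler_expR mulr_ge0 ?sqr_ge0.
Qed.

Lemma nb : n%:R = b3^-1 * b1^-1.
Proof. by rewrite n_expR /b3 /b1 !expRN !invrK -expRD; congr expR; field. Qed.

Lemma rb1 : b1 = r ^+ 4.
Proof. by rewrite /rate -expRM_natl; congr expR; field. Qed.

End Asymptotics.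

Section QnRange.
Context {R : realType} (n : nat).
Hypothesis n2 : (2 <= n)%N.

Lemma qn'_qn : (0 < @qn' R n)%N /\ (@qn' R n <= @qn R n < n)%N.
Proof.
have n1 : 1 <= n%:R :> R by rewrite ler1n (ltn_trans _ n2).
split; first by rewrite truncn_gt0 -[leLHS](powRr0 n%:R) ler_powR//; lra.
apply/andP; split; first by apply: le_truncn; rewrite ler_powR//; lra.
have l0 : 0 < ln n%:R :> R by rewrite ln_gt0// ltr1n.
rewrite truncn_lt_nat ?powR_ge0// /powR gt_eqF ?ltr0n ?(ltn_trans _ n2)//.
rewrite -[ltRHS](@lnK _ n%:R) ?posrE ?ltr0n ?(ltn_trans _ n2)// ltr_expR; lra.
Qed.

End QnRange.

(** * Bounds on the estimators when the two order statistics are near their quantiles *)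

Section Deterministic.
Context {R : realType} (n k0 : nat).
Local Notation z := (@Phibar_inv R).
Local Notation s := (@sqrt_ln R n).
Local Notation r := (@rate R n).
Hypothesis n0 : (0 < n)%N.
Hypothesis hs : 40 * 50 <= s.
Hypothesis hk : (k0 <= 9 * n %/ 10)%N.

Let q : R := (@qn R n)%:R.
Let q' : R := (@qn' R n)%:R.
Let N : R := n%:R.
Let N' : R := N - k0%:R.
Let b1 : R := expR (- (1 / 4 * s ^+ 2)).
Let b3 : R := expR (- (3 / 4 * s ^+ 2)).

Let D := z (q' / N') - z (q / N).

Lemma N'_bounds : N / 10 <= N' <= N.
Proof.
apply/andP; split; last by rewrite gerBl.
have : (10 * k0 <= 9 * n)%N by rewrite mulnC -leq_divRL.
rewrite -(ler_nat R) !natrM /N' /N; lra.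
Qed.

Lemma level_q' c : 0 < c <= 20 -> 0 < c * q' / N <= 20 * b3.
Proof.
move=> /andP[c0 c20]; have [h1 h3 _ _] := b_small hs; rewrite -/b1 -/b3 in h1 h3.
have /andP[q1 q2] := @qn'_bounds R n n0; rewrite -/b1 -/q' in q1 q2.
have N0 : 0 < N by rewrite ltr0n.
have NE : N = b3^-1 * b1^-1 by exact: nb n0.
have q0 : 0 < q' by apply: lt_le_trans q1; rewrite divr_gt0 ?invr_gt0.
rewrite divr_gt0 ?mulr_gt0//= NE invfM !invrK mulrA mulrAC.
have qb : q' * b1 <= 1 by rewrite -ler_pdivlMr// mul1r.
by rewrite ler_pM2r// -mulrA; apply: le_trans c20; rewrite ler_piMr// ltW.
Qed.

Lemma level_q c : 0 < c <= 20 -> 0 < c * q / N <= c * b1.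
Proof.
move=> /andP[c0 c20]; have [h1 h3 _ _] := b_small hs; rewrite -/b1 -/b3 in h1 h3.
have /andP[q1 q2] := @qn_bounds R n n0; rewrite -/b3 -/q in q1 q2.
have N0 : 0 < N by rewrite ltr0n.
have NE : N = b3^-1 * b1^-1 by exact: nb n0.
have q0 : 0 < q by apply: lt_le_trans q1; rewrite divr_gt0 ?invr_gt0.
rewrite divr_gt0 ?mulr_gt0//= NE invfM !invrK.
have qb : q * b3 <= 1 by rewrite -ler_pdivlMr// mul1r.
rewrite -mulrA ler_pM2l// mulrA ler_piMl// ltW//.
Qed.

Let q'0 : 0 < q'.
Proof. by have := level_q' (c := 1) ltac:(lra); rewrite mul1r => /andP[+ _]; rewrite pmulr_lgt0 ?invr_gt0 ?ltr0n. Qed.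

Let q0 : 0 < q.
Proof. by have := level_q (c := 1) ltac:(lra); rewrite mul1r => /andP[+ _]; rewrite pmulr_lgt0 ?invr_gt0 ?ltr0n. Qed.

Let N0 : 0 < N. Proof. by rewrite ltr0n. Qed.

Let N'0 : 0 < N'.
Proof. by have /andP[h _] := N'_bounds; have := N0; lra. Qed.

Let level_N' (x c : R) : 0 < x -> 0 <= c -> c * x / N' <= 10 * c * x / N.
Proof.
move=> x0 c0; have /andP[h _] := N'_bounds.
rewrite ler_pdivrMr// (_ : 10 * c * x / N * N' = c * x * (N' / (N / 10))); last first.
  by field; rewrite gt_eqF.
by rewrite ler_peMr ?mulr_ge0 ?(ltW x0)// ler_pdivlMr ?mul1r// divr_gt0.
Qed.

Let r0 : 0 < r /\ r <= 1 / (20 * 50).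
Proof. by split; [exact: expR_gt0|exact: r_le]. Qed.

Let zq'_ge c : 0 < c <= 2 -> s <= z (c * q' / N').
Proof.
move=> /andP[c0 c2]; apply: Phibar_inv_b3 => //; first by rewrite divr_gt0 ?mulr_gt0.
apply: le_trans (level_N' q'0 (ltW c0)) _.
by have /andP[_] := level_q' (c := 10 * c) ltac:(lra).
Qed.

Let zq_ge c : 0 < c <= 2 -> s / 2 <= z (c * q / N').
Proof.
move=> /andP[c0 c2]; apply: Phibar_inv_b1 => //; first by rewrite divr_gt0 ?mulr_gt0.
apply: le_trans (level_N' q0 (ltW c0)) _.
have [h1 _ _ _] := b_small hs.
by have /andP[_ /le_trans] := level_q (c := 10 * c) ltac:(lra); apply; rewrite ler_pM2r//; lra.
Qed.

Let kap : R := k0%:R / N.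
Let zb := z (q / N).
Let za := z (q' / N').

(** A relative error [expR x] on a level of quantile at least [w] moves the quantile by at most
    [x / w]; below, [w] is [s] or [s / 2]. *)
Lemma Phibar_inv_diff_le (a b w x : R) : 0 < a -> a <= b -> b < 1 / 2 -> 0 < w -> w <= z b ->
  b <= a * expR x -> z a - z b <= x / w.
Proof.
move=> a0 ab b2 w0 wb bx; have b0 : 0 < b by lra.
have := Phibar_inv_diff a0 ab b2.
have l : ln (b / a) <= x.
  by rewrite -[leRHS]expRK ler_ln ?posrE ?divr_gt0 ?expR_gt0// ler_pdivrMr// mulrC.
have d0 : 0 <= z a - z b.
  by rewrite subr_ge0 -Phibar_le !Phibar_invK//; lra.
move=> H; rewrite ler_pdivlMr//; apply: le_trans l; apply: le_trans H.
by rewrite mulrC ler_wpM2r.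
Qed.

Let zb_bounds : s / 2 <= zb <= 3 / 4 * s.
Proof.
have [h1 _ h2 _] := b_small hs.
have /andP[l1 l2] := level_q (c := 1) ltac:(lra); rewrite !mul1r in l1 l2.
have /andP[q1 q2] := @qn_bounds R n n0; rewrite -/b3 -/q in q1 q2.
apply/andP; split; first by apply: Phibar_inv_b1 => //; rewrite -/b1 in h1 *; lra.
apply: Phibar_inv_ub1 => //; rewrite -/b1 in h1 h2 *; first lra.
have NE : N = b3^-1 * b1^-1 := @nb R n n0.
rewrite ler_pdivlMr// NE; apply: le_trans q1.
by rewrite mulrAC mulrCA mulfV ?mulr1 ?gt_eqF.
Qed.

Let D_ge : s / 4 <= D.
Proof.
have := zq'_ge (c := 1) ltac:(lra); rewrite mul1r => h.
have /andP[_ h2] := zb_bounds; rewrite /D -/zb; lra.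
Qed.

(* Here [oq] and [oq'] stand for the order statistics of ranks [qn] and [qn']. *)
Lemma theta_sigma_lower (oq oq' : R) :
  - z ((1 - r) * q / N) < oq -> oq' <= - z ((1 + r) * q' / N') ->
  let S := (oq - oq') / D in
  1 - 20 * r / s ^+ 2 < S /\ - (20 * r / s) < oq + S * zb.
Proof.
move=> h1 h2 S; have [rp r1] := r0; have /andP[zb1 zb2] := zb_bounds; have Dge := D_ge.
have s0 : 0 < s by move: hs; lra.
have D0 : 0 < D by lra.
have [bp1 bp3 b11 b31] := b_small hs; rewrite -/b1 -/b3 in bp1 bp3 b11 b31.
have A : za - z ((1 + r) * q' / N') <= r / s.
  have /andP[l1 l2] := level_q' (c := 20) ltac:(lra).
  have lv := level_N' q'0 (c := 1 + r) ltac:(lra).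
  have p0 : 0 < q' / N' by rewrite divr_gt0.
  apply: Phibar_inv_diff_le => //.
  - by rewrite -mulrA ler_peMl// ltW// ltrDl.
  - apply: (le_lt_trans lv); apply: (@le_lt_trans _ _ (20 * q' / N)); last by lra.
    by rewrite !ler_pM2r ?invr_gt0//; lra.
  - by apply: zq'_ge; lra.
  - by rewrite -mulrA mulrC ler_wpM2l ?(ltW p0)// expR_ge1Dx.
have B : z ((1 - r) * q / N) - zb <= 2 * r / (s / 2).
  have /andP[l1 l2] := level_q (c := 1) ltac:(lra); rewrite !mul1r in l1 l2.
  apply: Phibar_inv_diff_le => //.
  - by rewrite -mulrA mulr_gt0//; lra.
  - by rewrite -mulrA ler_piMl// ?(ltW l1)//; lra.
  - lra.
  - lra.
  - rewrite -mulrA mulrAC -[leLHS]mul1r ler_pM2r//.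
    have h : (1 - r) * (1 + 2 * r) <= (1 - r) * expR (2 * r).
      by rewrite ler_wpM2l ?expR_ge1Dx//; lra.
    apply: le_trans h; nra.
pose e := r / s.
have re : r = e * s by rewrite /e divfK// gt_eqF.
have e0 : 0 < e by rewrite divr_gt0.
have es0 : 0 <= 20 * e / s by rewrite divr_ge0 ?(ltW s0)// mulr_ge0 ?(ltW e0).
have SD : S * D = oq - oq' by rewrite /S divfK// gt_eqF.
rewrite (_ : 20 * r / s ^+ 2 = 20 * e / s); last first.
  by rewrite re; field; rewrite gt_eqF.
rewrite (_ : 20 * r / s = 20 * e); last by rewrite /e; ring.
rewrite (_ : 2 * r / (s / 2) = 4 * e) in B; last by rewrite /e; field; rewrite gt_eqF.
rewrite -/e in A.
have S1 : 1 - 20 * e / s < S.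
  rewrite -(ltr_pM2r D0) SD mulrBl mul1r.
  have : 5 * e <= 20 * e / s * D.
    rewrite (_ : 5 * e = 20 * e / s * (s / 4)); last by field; rewrite gt_eqF.
    by rewrite ler_wpM2l.
  by rewrite /D -/za -/zb; lra.
split => //.
(* The location loses [4 * e] through [oq] and [15 * e] through the scale, since [zb] is at most
   [3 / 4 * s]. *)
have : (1 - 20 * e / s) * zb <= S * zb by rewrite ler_wpM2r ?(ltW S1)//; lra.
have : 20 * e / s * zb <= 20 * e / s * (3 / 4 * s).
  by rewrite ler_wpM2l.
rewrite (_ : 20 * e / s * (3 / 4 * s) = 15 * e); last by field; rewrite gt_eqF.
lra.
Qed.

(** Here each order statistic is compared with a level of the other sample size, [N] for [N'] or
    conversely. The ratio [N / N'] is at most [expR (10 * kap)], which shifts quantiles by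
    [O(kap / s)]: this is the contamination bias in [K]. *)
Lemma theta_sigma_upper (oq oq' : R) : let K := 120 * kap + 20 * r in
  oq <= - z ((1 + r) * q / N') -> - z ((1 - r) * q' / N) < oq' ->
  let S := (oq - oq') / D in
  S <= 1 + K / s ^+ 2 /\ oq + S * zb <= K / s.
Proof.
move=> K h1 h2 S; have [rp r1] := r0; have /andP[zb1 zb2] := zb_bounds; have Dge := D_ge.
have s0 : 0 < s by move: hs; lra.
have D0 : 0 < D by lra.
have k00 : 0 <= kap by rewrite divr_ge0.
have [bp1 bp3 b11 b31] := b_small hs; rewrite -/b1 -/b3 in bp1 bp3 b11 b31.
have /andP[N'1 N'2] := N'_bounds.
have ek : N / N' <= expR (10 * kap).
  apply: le_trans (expR_ge1Dx _).
  have kE : k0%:R = N - N' :> R by rewrite /N' opprB addrCA subrr addr0.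
  rewrite ler_pdivrMr// /kap kE.
  have : (N - N') * 1 <= (N - N') * (10 * (N' / N)).
    rewrite ler_wpM2l ?subr_ge0// mulrA ler_pdivlMr// mul1r; lra.
  have := N0 => N0'; rewrite (_ : (1 + _) * N' = N' + (N - N') * (10 * (N' / N))); last first.
    by field; rewrite gt_eqF.
  lra.
have A : z ((1 - r) * q' / N) - za <= (10 * kap + 2 * r) / s.
  have /andP[l1 l2] := level_q' (c := 20) ltac:(lra).
  have lv := level_N' q'0 (c := 1) ltac:(lra); rewrite !mul1r !mulr1 in lv.
  apply: Phibar_inv_diff_le => //.
  - by rewrite divr_gt0 ?mulr_gt0//; lra.
  - rewrite ler_pM ?invr_ge0 ?mulr_ge0 ?(ltW q'0)//; try lra.
      by rewrite ler_piMl ?(ltW q'0)//; lra.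
    by rewrite lef_pV2.
  - apply: (le_lt_trans lv); apply: (@le_lt_trans _ _ (20 * q' / N)); last by lra.
    by rewrite !ler_pM2r ?invr_gt0//; lra.
  - by have := zq'_ge (c := 1) ltac:(lra); rewrite mul1r.
  - rewrite expRD (_ : q' / N' = (q' / N) * (1 * (N / N'))); last by field; rewrite !gt_eqF.
    rewrite [leRHS](_ : _ = (q' / N) * ((1 - r) * expR (2 * r) * expR (10 * kap))); last by ring.
    rewrite ler_pM2l ?divr_gt0//; apply: ler_pM => //; first by rewrite divr_ge0 ?(ltW N0) ?(ltW N'0).
    have h : (1 - r) * (1 + 2 * r) <= (1 - r) * expR (2 * r).
      by rewrite ler_wpM2l ?expR_ge1Dx//; lra.
    apply: le_trans h; nra.
have B : zb - z ((1 + r) * q / N') <= (10 * kap + r) / (s / 2).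
  have /andP[l1 l2] := level_q (c := 20) ltac:(lra).
  have lv := level_N' q0 (c := 1 + r) ltac:(lra).
  apply: Phibar_inv_diff_le => //.
  - by rewrite divr_gt0.
  - rewrite ler_pM ?invr_ge0 ?(ltW q0)//; try lra.
      by rewrite ler_peMl ?(ltW q0)//; lra.
    by rewrite lef_pV2.
  - apply: (le_lt_trans lv); apply: (@le_lt_trans _ _ (20 * q / N)); last by lra.
    by rewrite !ler_pM2r ?invr_gt0//; lra.
  - lra.
  - by apply: zq_ge; lra.
  - rewrite expRD (_ : (1 + r) * q / N' = (q / N) * ((N / N') * (1 + r))); last by field; rewrite !gt_eqF.
    by rewrite ler_pM2l ?divr_gt0// ler_pM ?divr_ge0 ?expR_ge1Dx ?(ltW N0) ?(ltW N'0)//; lra.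
pose f := K / s.
have f0 : 0 <= f by rewrite divr_ge0 ?(ltW s0)// /K; lra.
have SD : S * D = oq - oq' by rewrite /S divfK// gt_eqF.
have Kf : K = f * s by rewrite /f divfK// gt_eqF.
rewrite (_ : K / s ^+ 2 = f / s); last by rewrite Kf; field; rewrite gt_eqF.
(* The quantile errors must fit in a quarter of [K / s] because the gap is only bounded below by
   [s / 4]; whence [120 = 4 * 30]. *)
have AB : (10 * kap + 2 * r) / s + (10 * kap + r) / (s / 2) <= f / 4.
  rewrite (_ : _ + _ = (30 * kap + 4 * r) / s); last by field; rewrite gt_eqF.
  by rewrite /f mulrAC ler_pM2r ?invr_gt0// /K; lra.
have S1 : S <= 1 + f / s.
  rewrite -(ler_pM2r D0) SD mulrDl mul1r.
  have : f / s * (s / 4) <= f / s * D by rewrite ler_wpM2l// divr_ge0 ?(ltW s0).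
  rewrite (_ : f / s * (s / 4) = f / 4); last by field; rewrite gt_eqF.
  by rewrite /D -/za -/zb; lra.
split => //.
have : S * zb <= (1 + f / s) * zb by rewrite ler_wpM2r//; lra.
have : f / s * zb <= f / s * (3 / 4 * s).
  by rewrite ler_wpM2l// divr_ge0 ?(ltW s0).
rewrite (_ : f / s * (3 / 4 * s) = 3 / 4 * f); last by field; rewrite gt_eqF.
have : (10 * kap + 2 * r) / s >= 0 by rewrite divr_ge0 ?(ltW s0)//; lra.
rewrite -/f; lra.
Qed.

End Deterministic.

(** * The FDR bound *)

Section Expectation.
Context {R : realType} d (T : measurableType d) (P : probability T R).

Lemma expectation_ge0D (X Y : T -> R) :
  measurable_fun setT X -> measurable_fun setT Y ->
  (forall w, 0 <= X w) -> (forall w, 0 <= Y w) ->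
  ('E_P[fun w => (X w + Y w)%R] = 'E_P[X] + 'E_P[Y])%E.
Proof.
move=> mX mY X0 Y0; rewrite unlock -ge0_integralD//.
- by move=> w _; rewrite lee_fin.
- exact/measurable_EFinP.
- by move=> w _; rewrite lee_fin.
- exact/measurable_EFinP.
Qed.

Lemma expectation_sum_indic (J : finType) (c : J -> R) (B : J -> set T) :
  (forall j, 0 <= c j) -> (forall j, measurable (B j)) ->
  ('E_P[fun w => (\sum_j c j * \1_(B j) w)%R] = \sum_j (c j)%:E * P (B j))%E.
Proof.
move=> c0 mB; rewrite unlock.
under eq_integral do rewrite -sumEFin.
rewrite ge0_integral_sum//; last 2 first.
- by move=> j; apply/measurable_EFinP; apply: measurable_funM.
- by move=> j w _; rewrite lee_fin mulr_ge0.
apply: eq_bigr => j _; under eq_integral do rewrite EFinM.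
rewrite ge0_integralZl ?lee_fin//; last by apply/measurable_EFinP; exact: measurable_indic.
by rewrite integral_indic// setIT.
Qed.

Lemma measurable_sum_indic (J : finType) (c : J -> R) (B : J -> set T) :
  (forall j, measurable (B j)) -> measurable_fun setT (fun w => \sum_j c j * \1_(B j) w).
Proof. by move=> mB; apply: measurable_sum => j; apply: measurable_funM. Qed.

Lemma sum_disjoint_le1 (J : finType) (B : J -> set T) :
  (forall j, measurable (B j)) -> (forall w j k, B j w -> B k w -> j = k) ->
  \sum_j fine (P (B j)) <= 1.
Proof.
move=> mB dB; rewrite -lee_fin -sumEFin.
under eq_bigr do rewrite fineK ?fin_num_measure//.
have := @expectation_sum_indic J (fun=> 1) B (fun=> ler01) mB.
under [X in _ = X -> _]eq_bigr do rewrite mul1e.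
move=> <-; rewrite -(expectation_cst P 1); apply: expectation_le => //.
- exact: measurable_sum_indic.
- by move=> w; apply: sumr_ge0 => j _; rewrite mul1r.
- apply: aeW => w /=; case: (pselect (exists j, B j w)) => [[j Bj]|nB].
    rewrite (bigD1 j)//= big1 ?addr0 ?mul1r ?indicE; first by case: (_ \in _).
    move=> k kj; rewrite indicE memNset ?mulr0// => Bk.
    by move/negP: kj; apply; apply/eqP; exact: dB Bk Bj.
  rewrite big1// => j _; rewrite indicE memNset ?mulr0// => Bj.
  by apply: nB; exists j.
Qed.

End Expectation.

(** * Affine equivariance: reduction to location 0 and scale 1 *)

Section Equivariance.
Context {R : realType} {n : nat}.
Hypothesis n2 : (2 <= n)%N.
Implicit Types y : 'I_n -> R.

Let qrange : (0 < @qn R n <= n)%N.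
Proof. by have [h1 /andP[h2 h3]] := @qn'_qn R n n2; rewrite (leq_trans h1 h2) ltnW. Qed.

Let q'range : (0 < @qn' R n <= n)%N.
Proof. by have [h1 /andP[h2 h3]] := @qn'_qn R n n2; rewrite h1 (leq_trans h2)// ltnW. Qed.

Lemma sigma_plus_affine k0 y (a b : R) : 0 < b ->
  sigma_plus k0 (fun i => a + b * y i) = b * sigma_plus k0 y.
Proof.
move=> b0; rewrite /sigma_plus !order_stat_affine// mulrA; congr (_ / _).
ring.
Qed.

Lemma theta_plus_affine k0 y (a b : R) : 0 < b ->
  theta_plus k0 (fun i => a + b * y i) = a + b * theta_plus k0 y.
Proof.
by move=> b0; rewrite /theta_plus sigma_plus_affine// order_stat_affine//; ring.
Qed.

Lemma BH_affine alpha y (a b u s : R) : 0 < b ->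
  BH alpha (fun i => a + b * y i) (a + b * u) (b * s) = BH alpha y u s.
Proof.
move=> b0; rewrite /BH.
suff -> : pvalue (fun i => a + b * y i) (a + b * u) (b * s) = pvalue y u s by [].
apply/funext => i; rewrite /pvalue; congr Phibar.
rewrite invfM mulrA; congr (_ / _).
rewrite (_ : _ - _ = b * (y i - u)); last by ring.
by rewrite mulrAC mulfV ?mul1r// gt_eqF.
Qed.

Lemma BH_plus_affine alpha k0 y (a b : R) : 0 < b ->
  BH_plus alpha k0 (fun i => a + b * y i) = BH_plus alpha k0 y.
Proof. by move=> b0; rewrite /BH_plus (theta_plus_affine _ _ _ b0) (sigma_plus_affine _ _ _ b0); exact: BH_affine. Qed.

Lemma BH_oracle_affine alpha y (a b : R) : 0 < b ->
  BH alpha (fun i => a + b * y i) a b = BH alpha y 0 1.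
Proof. by move=> b0; rewrite -[RHS](BH_affine alpha y a 0 1 b0) mulr0 addr0 mulr1. Qed.

End Equivariance.

(** * Replacing a rejected observation by an outlier *)

Section Rejection.
Context {R : realType} {n : nat}.
Hypothesis n2 : (2 <= n)%N.
Variables (alpha : R) (k0 : nat) (y : 'I_n -> R) (i : 'I_n).
Hypothesis a0 : 0 < alpha.
Hypothesis a4 : alpha < 4 / 10.
Hypothesis S0 : 0 < sigma_plus k0 y.
Hypothesis zq : 0 <= @Phibar_inv R ((@qn R n)%:R / n%:R).
Hypothesis iBH : i \in BH_plus alpha k0 y.

Let U := theta_plus k0 y.
Let S := sigma_plus k0 y.
Let l := #|BH_plus alpha k0 y|.
Let t := alpha * l%:R / n%:R.

Lemma BH_plus_level : [/\ (0 < l <= n)%N, 0 < t & t < 1 / 2].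
Proof.
have n0 : 0 < n%:R :> R by rewrite ltr0n (ltn_trans _ n2).
have l0 : (0 < l)%N by rewrite /l card_gt0; apply/set0Pn; exists i.
have ln : (l <= n)%N by rewrite -[X in (_ <= X)%N](card_ord n) max_card.
split; first by rewrite l0.
  by rewrite divr_gt0// mulr_gt0// ltr0n.
rewrite ltr_pdivrMr//; have : l%:R <= n%:R :> R by rewrite ler_nat.
move: a0 a4 => h1 h2; nra.
Qed.

Lemma BH_plus_reject : U + S * Phibar_inv t <= y i.
Proof.
have [_ t0 t1] := BH_plus_level.
have : pvalue y U S i <= t.
  by have := iBH; rewrite /BH_plus inE /t /l card_BH// ltW.
rewrite /pvalue -Phibar_inv_le; last by lra.
by rewrite ler_pdivlMr// mulrC; lra.
Qed.

(** The rejection bound is [Y_(qn)] plus [S] times two quantiles, one nonnegative by [zq] and the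
    other positive because the level [t] is below [1 / 2]. *)
Lemma BH_plus_reject_gt : order_stat y (@qn R n) < y i.
Proof.
have [_ t0 t1] := BH_plus_level.
apply: lt_le_trans BH_plus_reject; rewrite /U /theta_plus -/S -addrA ltrDl.
apply: ltr_wpDl; first by rewrite mulr_ge0 ?(ltW S0).
by rewrite mulr_gt0 ?Phibar_inv_gt0.
Qed.

Lemma sigma_plus_outlier : sigma_plus k0 (outlier i y) = S.
Proof.
have [h1 /andP[h2 h3]] := @qn'_qn R n n2; have yi := BH_plus_reject_gt.
rewrite /S /sigma_plus !order_stat_outlier//.
- by rewrite h1 (leq_ltn_trans h2).
- by apply: le_lt_trans yi; apply: order_stat_mono; rewrite ?h2 ?(ltnW h3).
- by rewrite (leq_trans h1).
Qed.

Lemma theta_plus_outlier : theta_plus k0 (outlier i y) = U.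
Proof.
have [h1 /andP[h2 h3]] := @qn'_qn R n n2; have yi := BH_plus_reject_gt.
by rewrite /U /theta_plus sigma_plus_outlier order_stat_outlier// (leq_trans h1).
Qed.

Lemma BH_ell_outlier : BH_ell_out alpha (pvalue (outlier i y) U S) i = l.
Proof.
rewrite (@BH_ell_out_eq _ _ _ _ (pvalue y U S)); last first.
  by move=> j ji; rewrite /pvalue /outlier (negbTE ji).
rewrite /l /BH_plus card_BH ?(ltW a0)//; apply: BH_ell_outE; first exact: ltW.
by have := iBH; rewrite /BH_plus inE.
Qed.

End Rejection.

(** * The Gaussian tail at a perturbed rejection threshold *)

Section TailBound.
Context {R : realType} (n : nat).
Local Notation s := (@sqrt_ln R n).
Local Notation r := (@rate R n).
Hypothesis n0 : (0 < n)%N.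
Hypothesis hs : 40 * 50 <= s.

(** [Phibar (1 / 10)] is at least [1 / 2 - 1 / 10], as the density is at most 1: levels up to
    [4 / 10] keep the quantile away from 0. *)
Lemma Phibar_inv_ge_tenth (t : R) : 0 < t -> t <= 4 / 10 -> 1 / 10 <= Phibar_inv t.
Proof.
move=> t0 t4; rewrite Phibar_inv_ge; last by lra.
have := @Phibar_lip R 0 (1 / 10) ltac:(lra); rewrite Phibar0; lra.
Qed.

Lemma expR_le2 (x : R) : x <= 1 / 2 -> expR x <= 2.
Proof.
move=> x2; have := expR_ge1Dx (- x); rewrite expRN => h.
have e0 := expR_gt0 x.
have : (1 / 2) * expR x <= (expR x)^-1 * expR x by rewrite ler_pM2r//; lra.
by rewrite mulVf ?gt_eqF//; lra.
Qed.

(** For levels at least [n^(-3)] the quantile is [O(s)], so the estimation errors shift it by at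
    most [70 * r / s], and [Phibar_drop] gives a relative error [8 * 3 * 70 * 2 = 60 * 56] times
    [r]. *)
Lemma tail_bound_large (t : R) : 0 < t -> t <= 4 / 10 -> expR (- (3 * s ^+ 2)) <= t ->
  Phibar ((1 - 20 * r / s ^+ 2) * Phibar_inv t - 20 * r / s) <= t * (1 + 60 * (56 * r)).
Proof.
move=> t0 t4 tn; set z := Phibar_inv t.
have hs' := hs; have s0 : 0 < s by lra.
have [rp _] := @r_small R n; have r1 := r_le hs.
have z1 : 1 / 10 <= z by exact: Phibar_inv_ge_tenth.
have z2 : z <= 5 / 2 * s.
  have := Phibar_inv_sqr t0 (t := t) ltac:(lra); rewrite -/z.
  have : ln t^-1 <= 3 * s ^+ 2.
    rewrite -[leRHS]expRK ler_ln ?posrE ?invr_gt0 ?expR_gt0//.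
    by rewrite invf_ple ?posrE ?expR_gt0// -expRN.
  move=> h1 h2; rewrite -(@ler_pXn2r _ 2) ?nnegrE ?exprMn; [|by []|lra|lra].
  by have := sqr_ge0 s; lra.
pose e := r / s.
have e0 : 0 < e by rewrite divr_gt0.
have es : e * s = r by rewrite /e divfK// gt_eqF.
have esm : e * (40 * 50) <= r by rewrite -es ler_wpM2l// ltW.
have zh : z - 70 * e <= (1 - 20 * r / s ^+ 2) * z - 20 * r / s.
  rewrite (_ : 20 * r / s ^+ 2 = 20 * e / s); last by rewrite -es; field; rewrite gt_eqF.
  rewrite (_ : 20 * r / s = 20 * e); last by rewrite /e; ring.
  have : 20 * e / s * z <= 20 * e / s * (5 / 2 * s).
    by rewrite ler_wpM2l// divr_ge0 ?(ltW s0)// mulr_ge0 ?(ltW e0).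
  rewrite (_ : 20 * e / s * (5 / 2 * s) = 50 * e); last by field; rewrite gt_eqF.
  lra.
apply: (le_trans (Phibar_noninc zh)).
apply: (le_trans (@Phibar_drop _ z (70 * e) _ _)); [lra|lra|].
rewrite Phibar_invK; last by lra.
rewrite ler_pM2l// lerD2l.
have ze : z * (70 * e) <= 175 * r.
  have : z * e <= 5 / 2 * s * e by rewrite ler_pM2r.
  lra.
have E2 : expR (z * (70 * e)) <= 2 by apply: expR_le2; lra.
have h1 : (z + 1) * e <= 3 * r.
  have : (z + 1) * e <= 3 * s * e by rewrite ler_pM2r//; lra.
  lra.
have h2 : 8 * (z + 1) * (70 * e) * expR (z * (70 * e)) <= 8 * (z + 1) * (70 * e) * 2.
  have p : 0 <= 8 * (z + 1) * (70 * e) by apply: mulr_ge0; lra.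
  by rewrite ler_wpM2l.
lra.
Qed.

(** Below [n^(-3)] the quantile is no longer controlled; monotonicity compares with the level
    [n^(-3)], whose perturbed tail is at most five times itself. *)
Lemma tail_bound (t : R) : 0 < t -> t <= 4 / 10 ->
  Phibar ((1 - 20 * r / s ^+ 2) * Phibar_inv t - 20 * r / s)
    <= t * (1 + 60 * (56 * r)) + 5 * expR (- (3 * s ^+ 2)).
Proof.
move=> t0 t4; have hs' := hs; have s0 : 0 < s by lra.
have [rp _] := @r_small R n; have r1 := r_le hs.
set t1 := expR (- (3 * s ^+ 2)).
have t00 : 0 < t1 by exact: expR_gt0.
case: (leP t1 t) => [h|/ltW h].
  by apply: (le_trans (tail_bound_large t0 t4 h)); lra.
have h3 : t1 <= 1 / 100.
  by have /andP[_] := @expRN_small R n hs 3 ltac:(lra).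
have H := tail_bound_large t00 ltac:(lra) (lexx _).
have : Phibar ((1 - 20 * r / s ^+ 2) * Phibar_inv t - 20 * r / s) <=
    Phibar ((1 - 20 * r / s ^+ 2) * Phibar_inv t1 - 20 * r / s).
  apply: Phibar_noninc; rewrite lerD2r ler_wpM2l//.
    have ss1 : 1 <= s ^+ 2 by rewrite expr2; nra.
    rewrite subr_ge0 ler_pdivrMr ?exprn_gt0//; lra.
  by rewrite -Phibar_le !Phibar_invK//; lra.
have : t1 * (60 * (56 * r)) <= t1 * 4 by rewrite ler_pM2l//; lra.
have : 0 <= t * (1 + 60 * (56 * r)) by apply: mulr_ge0; [exact: ltW|lra].
lra.
Qed.

End TailBound.

(** * The estimators are accurate outside events of probability [O(r^2)] *)

Section PartOne.
Context {R : realType} {n : nat} d (T : measurableType d) (P : probability T R).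
Variables (pi : 'I_n -> probability (measurableTypeR R) R).
Variables (eps : 'I_n -> {RV P >-> measurableTypeR R}).
Variables (alpha : R) (k0 : nat).
Local Notation s := (@sqrt_ln R n).
Local Notation r := (@rate R n).
Local Notation z := (@Phibar_inv R).
Hypothesis n2 : (2 <= n)%N.
Hypothesis hs : 40 * 50 <= s.
Hypothesis noise : OSC_noise pi eps.
Hypothesis dom : forall i, dominates_normal (pi i).
Hypothesis hk : (n1 pi <= k0 <= 9 * n %/ 10)%N.

Let E w i := eps i w.
Let q := @qn R n.
Let q' := @qn' R n.

Let n0 : (0 < n)%N. Proof. exact: ltn_trans n2. Qed.
Let Nn0 : 0 < n%:R :> R. Proof. by rewrite ltr0n. Qed.
Let k0n : (k0 <= 9 * n %/ 10)%N. Proof. by case/andP: hk. Qed.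

Let r01 : 0 < r /\ r <= 1 / (20 * 50).
Proof. by split; [exact: expR_gt0|exact: r_le]. Qed.

Let q'0 : 0 < q'%:R :> R.
Proof. by rewrite ltr0n; case: (@qn'_qn R n n2). Qed.

(** The choice of [rate]: [qn'] is at least [r^(-4) / 2], so a Chebyshev bound of order
    [1 / (qn' * r ^+ 2)] is [O(r^2)]. *)
Let inv_q' : 2 / (q'%:R * r ^+ 2) <= 4 * r ^+ 2.
Proof.
have [rp _] := r01; have /andP[h _] := @qn'_bounds R n n0.
have b0 : 0 < r ^+ 4 by rewrite exprn_gt0.
rewrite (@rb1 R n) in h.
rewrite ler_pdivrMr ?mulr_gt0 ?exprn_gt0//.
have : (r ^+ 4)^-1 / 2 * r ^+ 4 <= q'%:R * r ^+ 4 by rewrite ler_pM2r.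
rewrite mulrAC mulVf ?gt_eqF//.
rewrite (_ : 4 * r ^+ 2 * (q'%:R * r ^+ 2) = 4 * (q'%:R * r ^+ 4)); last by ring.
lra.
Qed.

Let inv_q : 2 / (q%:R * r ^+ 2) <= 4 * r ^+ 2.
Proof.
apply: le_trans inv_q'; have [rp _] := r01.
rewrite ler_wpM2l// lef_pV2 ?posrE ?mulr_gt0 ?exprn_gt0//.
  by rewrite ler_pM2r ?exprn_gt0// ler_nat; case: (@qn'_qn R n n2) => _ /andP[].
by rewrite ltr0n; case: (@qn'_qn R n n2) => h /andP[h1 _]; exact: leq_trans h1.
Qed.

(** Failure of the deviations used to bound both estimators from below: [Y_(qn)] too small or
    [Y_(qn')] too large. [bad_upper] is its counterpart for upper bounds. *)
Definition bad_lower : set T :=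
  [set w | order_stat (E w) q <= - z ((1 - r) * q%:R / n%:R)] `|`
  [set w | - z ((1 + r) * q'%:R / (n%:R - k0%:R)) < order_stat (E w) q'].

Definition bad_upper : set T :=
  [set w | - z ((1 + r) * q%:R / (n%:R - k0%:R)) < order_stat (E w) q] `|`
  [set w | order_stat (E w) q' <= - z ((1 - r) * q'%:R / n%:R)].

Let mle x q0 : measurable [set w | order_stat (E w) q0 <= x].
Proof. exact: measurable_order_stat_le. Qed.

Let mgt x q0 : measurable [set w | x < order_stat (E w) q0].
Proof.
rewrite (_ : [set w | _] = ~` [set w | order_stat (E w) q0 <= x]); first exact: measurableC.
by apply/seteqP; split => w /=; rewrite ltNge => /negP.
Qed.

Lemma measurable_bad_lower : measurable bad_lower.
Proof. exact: measurableU. Qed.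

Lemma measurable_bad_upper : measurable bad_upper.
Proof. exact: measurableU. Qed.

Let dev_lower q0 : (0 < q0 <= n)%N -> 2 / (q0%:R * r ^+ 2) <= 4 * r ^+ 2 ->
  0 < (1 - r) * q0%:R / n%:R < 1 ->
  (P [set w | (order_stat (E w) q0 <= - z ((1 - r) * q0%:R / n%:R))%R] <= (4 * r ^+ 2)%:E)%E.
Proof.
move=> hq h1 h2; have [rp _] := r01.
apply: (le_trans (order_stat_dev_lower noise dom hq rp _)).
  by rewrite Phibar_invK// mulrC divfK ?gt_eqF// mulrC.
rewrite lee_fin; apply: le_trans h1; rewrite ler_wpM2r//; last lra.
by rewrite invr_ge0 mulr_ge0// sqr_ge0.
Qed.

Let dev_upper q0 : (0 < q0 <= n)%N -> 2 / (q0%:R * r ^+ 2) <= 4 * r ^+ 2 ->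
  0 < (1 + r) * q0%:R / (n%:R - k0%:R) < 1 ->
  (P [set w | (- z ((1 + r) * q0%:R / (n%:R - k0%:R)) < order_stat (E w) q0)%R] <= (4 * r ^+ 2)%:E)%E.
Proof.
move=> hq h1 h2; have [rp r1] := r01; have /andP[N1 N2] := @N'_bounds R n k0 k0n.
have N'0 : 0 < n%:R - k0%:R :> R by have := Nn0; lra.
apply: (le_trans (order_stat_dev_upper noise dom hq (r := r) _ _)); last by rewrite lee_fin.
  lra.
(* The level is built from [k0], the deviation bound from the true number of contaminated
   coordinates; [n1 pi <= k0] compares them. *)
rewrite Phibar_invK// mulrA ler_pdivlMr// mulrC [q0%:R * _]mulrC ler_wpM2r//.
  by rewrite mulr_ge0//; lra.
by rewrite lerD2l lerN2 ler_nat; case/andP: hk.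
Qed.

Let qrange : (0 < q <= n)%N /\ (0 < q' <= n)%N.
Proof.
have [h1 /andP[h2 h3]] := @qn'_qn R n n2.
by rewrite (leq_trans h1 h2) (ltnW h3) h1 (leq_trans h2 (ltnW h3)).
Qed.

Let levels (c : R) : 0 < c <= 2 ->
  [/\ 0 < c * q%:R / n%:R < 1, 0 < c * q'%:R / n%:R < 1,
      0 < c * q%:R / (n%:R - k0%:R) < 1 & 0 < c * q'%:R / (n%:R - k0%:R) < 1].
Proof.
move=> hc; have [b1 b3 b11 b31] := @b_small R n hs.
have /andP[l1 l2] := @level_q R n n0 hs (10 * c) ltac:(lra).
have /andP[l3 l4] := @level_q' R n n0 hs (10 * c) ltac:(lra).
have /andP[N1 N2] := @N'_bounds R n k0 k0n; have Nn0' := Nn0.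
have N'0 : 0 < n%:R - k0%:R :> R by lra.
have inv : (n%:R - k0%:R)^-1 <= 10 / n%:R :> R.
  by rewrite -[leRHS]invrK invf_div lef_pV2 ?posrE ?divr_gt0.
have inv0 : 0 < (n%:R - k0%:R)^-1 :> R by rewrite invr_gt0.
have aux (x : R) : 0 < 10 * c * x / n%:R -> 10 * c * x / n%:R < 1 ->
    0 < c * x / n%:R < 1 /\ 0 < c * x / (n%:R - k0%:R) < 1.
  rewrite (_ : 10 * c * x / n%:R = 10 * (c * x / n%:R)); last by ring.
  move=> h1 h2; have cx0 : 0 < c * x by have := h1; rewrite pmulr_rgt0// pmulr_lgt0 ?invr_gt0.
  split; first lra.
  rewrite divr_gt0//=; apply: le_lt_trans h2.
  by rewrite mulrCA ler_pM2l// mulrC [X in X * _]mulrC mulrC.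
have l5 : 10 * c * expR (- (1 / 4 * s ^+ 2)) <= 20 * expR (- (1 / 4 * s ^+ 2)).
  by rewrite ler_pM2r//; lra.
have [h1 h2] := aux _ l1 ltac:(lra).
by have [h3 h4] := aux _ l3 ltac:(lra).
Qed.

Lemma prob_bad_lower : (P bad_lower <= (8 * r ^+ 2)%:E)%E.
Proof.
have [rp r1] := r01; have [hq hq'] := qrange.
apply: (@le_trans _ _ ((4 * r ^+ 2)%:E + (4 * r ^+ 2)%:E)%E); last first.
  by rewrite -EFinD lee_fin; lra.
apply: (le_trans (measureU2 _ _ _)) => //; apply: leeD.
- by apply: dev_lower => //; case: (levels (c := 1 - r) ltac:(lra)).
- by apply: dev_upper => //; case: (levels (c := 1 + r) ltac:(lra)).
Qed.

Lemma prob_bad_upper : (P bad_upper <= (8 * r ^+ 2)%:E)%E.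
Proof.
have [rp r1] := r01; have [hq hq'] := qrange.
apply: (@le_trans _ _ ((4 * r ^+ 2)%:E + (4 * r ^+ 2)%:E)%E); last first.
  by rewrite -EFinD lee_fin; lra.
apply: (le_trans (measureU2 _ _ _)) => //; apply: leeD.
- by apply: dev_upper => //; case: (levels (c := 1 + r) ltac:(lra)).
- by apply: dev_lower => //; case: (levels (c := 1 - r) ltac:(lra)).
Qed.

Definition good (U S : R) : Prop := 1 - 20 * r / s ^+ 2 < S /\ - (20 * r / s) < U.

Lemma good_lower w : ~ bad_lower w -> good (theta_plus k0 (E w)) (sigma_plus k0 (E w)).
Proof.
move=> /not_orP[/= /negP]; rewrite -ltNge => h1 /negP; rewrite -leNgt => h2.
exact: (theta_sigma_lower n0 hs k0n h1 h2).
Qed.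

Lemma good_upper w : ~ bad_upper w -> let K := 120 * (k0%:R / n%:R) + 20 * r in
  sigma_plus k0 (E w) <= 1 + K / s ^+ 2 /\ theta_plus k0 (E w) <= K / s.
Proof.
move=> /not_orP[/= /negP]; rewrite -leNgt => h1 /negP; rewrite -ltNge => h2.
exact: (theta_sigma_upper n0 hs k0n h1 h2).
Qed.

End PartOne.

(** * Leave-one-out decomposition of the FDP *)

Section ErrorBound.
Context {R : realType} {n : nat} d (T : measurableType d) (P : probability T R).
Variables (pi : 'I_n -> probability (measurableTypeR R) R).
Variables (eps : 'I_n -> {RV P >-> measurableTypeR R}).
Variables (alpha : R) (k0 : nat).
Local Notation s := (@sqrt_ln R n).
Local Notation r := (@rate R n).
Local Notation z := (@Phibar_inv R).
Hypothesis n2 : (2 <= n)%N.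
Hypothesis noise : OSC_noise pi eps.
Hypothesis a0 : 0 < alpha.
Hypothesis a4 : alpha < 4 / 10.

Let E w i := eps i w.

Lemma measurable_BH_plus alpha' (psi : {set 'I_n} -> R) :
  measurable_fun setT (fun w => psi (BH_plus alpha' k0 (E w))).
Proof.
have me i : measurable_fun setT (eps i : T -> R) := measurable_eps eps i.
apply: (measurable_BH_fun me).
  exact: measurable_theta_plus.
exact: measurable_sigma_plus.
Qed.

Lemma FDP_ge0 (D : {set 'I_n}) : 0 <= FDP pi D.
Proof. by rewrite /FDP divr_ge0. Qed.

Lemma FDP_le1 (D : {set 'I_n}) : FDP pi D <= 1.
Proof.
rewrite /FDP ler_pdivrMr ?mul1r ?ltr0n ?leq_max ?orbT// ler_nat leq_max.
by rewrite subset_leq_card ?subsetIl.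
Qed.

Lemma expectation_le1 (X : T -> R) : measurable_fun setT X -> (forall w, 0 <= X w <= 1) ->
  ('E_P[X] <= 1)%E.
Proof.
move=> mX X01; rewrite -(expectation_cst P 1); apply: expectation_le => //.
- by move=> w; case/andP: (X01 w).
- by apply: aeW => w /=; case/andP: (X01 w).
Qed.

(* The event that the estimators computed without [Y_i] are good and that there
   are [k + 1] rejections when [Y_i] is replaced by an outlier. *)
Definition out_event (i k : 'I_n) : set T :=
  [set w | @good R n (theta_plus k0 (outlier i (E w))) (sigma_plus k0 (outlier i (E w)))] `&`
  [set w | BH_ell_out alpha (pvalue (outlier i (E w))
     (theta_plus k0 (outlier i (E w))) (sigma_plus k0 (outlier i (E w)))) i = k.+1].

Definition threshold (k : 'I_n) : R :=
  (1 - 20 * r / s ^+ 2) * z (alpha * k.+1%:R / n%:R) - 20 * r / s.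

(** The outlier vector reads only the coordinates other than [i]. These are measurable on [T'], that
    is [T] with the sigma-algebra of the cylinders, so the general measurability lemmas apply
    there. *)
Lemma rest_out_event i k : <<s rest_cylinders eps i >> (out_event i k).
Proof.
pose T' := g_sigma_algebraType (rest_cylinders eps i).
have me j : j != i -> measurable_fun [set: T'] (eps j : T' -> R).
  move=> ji _ B mB; rewrite setTI; apply: sub_sigma_algebra.
  exists (fun l => if l == j then B else setT); first by move=> l; case: ifP.
  apply/seteqP; split => w /=.
    by move=> Bw l _ /=; case: eqVneq => [->|].
  by move=> Hw; have := Hw j; rewrite /= eqxx; apply; rewrite !inE.
have mo j := @measurable_outlier R _ T' n (fun l => (eps l : T' -> R)) i j me.
have mt := measurable_theta_plus mo k0; have ms := measurable_sigma_plus mo k0.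
have : measurable ([set w : T' | 1 - 20 * r / s ^+ 2 < sigma_plus k0 (outlier i (E w))] `&`
  [set w : T' | - (20 * r / s) < theta_plus k0 (outlier i (E w))] `&`
  [set w : T' | BH_ell_out alpha (pvalue (outlier i (E w))
     (theta_plus k0 (outlier i (E w))) (sigma_plus k0 (outlier i (E w)))) i = k.+1]).
  apply: measurableI; first apply: measurableI.
  - exact: measurable_lt.
  - exact: measurable_lt.
  - exact: measurable_BH_ell_out.
by congr (_ _); apply/seteqP; split => w; rewrite /out_event /good /=; tauto.
Qed.

Lemma measurable_out_event i k : measurable (out_event i k).
Proof.
have := @rest_out_event i k; apply: smallest_sub; first exact: sigma_algebra_measurable.
move=> _ [C mC ->]; apply: fin_bigcap_measurable; first exact: finite_finset.
by move=> j _; exact: measurable_noise.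
Qed.

Hypothesis hs : 40 * 50 <= s.
Hypothesis dom : forall i, dominates_normal (pi i).
Hypothesis hk : (n1 pi <= k0 <= 9 * n %/ 10)%N.

Let n0 : (0 < n)%N. Proof. exact: ltn_trans n2. Qed.
Let Nn0 : 0 < n%:R :> R. Proof. by rewrite ltr0n. Qed.

Let r01 : 0 < r /\ r <= 1 / (20 * 50).
Proof. by split; [exact: expR_gt0|exact: r_le]. Qed.

Lemma sigma_lower_half (S : R) : 1 - 20 * r / s ^+ 2 < S -> 1 / 2 < S.
Proof.
apply: le_lt_trans; have [rp r1] := r01; have hs' := hs.
have ss1 : 1 <= s ^+ 2 by rewrite expr_ge1//; lra.
have : 20 * r / s ^+ 2 <= 1 / 2 by rewrite ler_pdivrMr; lra.
lra.
Qed.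

Lemma Phibar_inv_q_ge0 : 0 <= z ((@qn R n)%:R / n%:R).
Proof.
have [b1 _ b11 _] := @b_small R n hs.
have /andP[l1 l2] := @level_q R n n0 hs 1 ltac:(lra).
by apply/ltW/Phibar_inv_gt0; lra.
Qed.

(** On the bad event the FDP is at most 1. Off it, a rejected null [i] among [k + 1] rejections may
    be replaced by an outlier, so [out_event i k] holds, [eps i] exceeds the threshold, and [i]
    contributes [1 / (k + 1)]. *)
Lemma FDP_BH_plus_le w : FDP pi (BH_plus alpha k0 (E w)) <=
  \1_(bad_lower eps k0) w + \sum_(p : 'I_n * 'I_n)
    ((p.1 \in H0 pi)%:R / p.2.+1%:R) *
      \1_(out_event p.1 p.2 `&` eps p.1 @^-1` `]threshold p.2, +oo[%classic) w.
Proof.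
have sum0 : 0 <= \sum_(p : 'I_n * 'I_n)
    ((p.1 \in H0 pi)%:R / p.2.+1%:R) *
      \1_(out_event p.1 p.2 `&` eps p.1 @^-1` `]threshold p.2, +oo[%classic) w :> R.
  by apply: sumr_ge0 => p _; rewrite mulr_ge0// divr_ge0.
case: (pselect (bad_lower eps k0 w)) => [b|nb].
  apply: (le_trans (FDP_le1 _)); rewrite indicE mem_set// lerDl//.
have k0n : (k0 <= 9 * n %/ 10)%N by case/andP: hk.
have [gS gU] := good_lower n2 hs hk nb.
have S0 : 0 < sigma_plus k0 (E w) by have := sigma_lower_half gS; lra.
rewrite [leRHS](_ : _ = \sum_i \sum_(k < n) (i \in H0 pi)%:R / k.+1%:R *
      \1_(out_event i k `&` eps i @^-1` `]threshold k, +oo[%classic) w); last first.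
  by rewrite indicE memNset// add0r [RHS]pair_bigA.
rewrite FDP_sum big_mkcond; apply: ler_sum => i _.
have rhs0 : 0 <= \sum_(k < n) (i \in H0 pi)%:R / k.+1%:R *
      \1_(out_event i k `&` eps i @^-1` `]threshold k, +oo[%classic) w :> R.
  by apply: sumr_ge0 => p _; rewrite mulr_ge0// divr_ge0.
case: (boolP (i \in H0 pi)) rhs0 => iH rhs0 //.
case: (boolP (i \in BH_plus alpha k0 (E w))) => iB; last by rewrite mul0r.
have [/andP[l0 ln] t0 t1] := BH_plus_level n2 a0 a4 iB.
have rej := BH_plus_reject n2 a0 a4 S0 iB.
have eS := sigma_plus_outlier n2 a0 a4 S0 Phibar_inv_q_ge0 iB.
have eU := theta_plus_outlier n2 a0 a4 S0 Phibar_inv_q_ge0 iB.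
have eL := BH_ell_outlier a0 iB.
set l := #|_| in l0 ln t0 t1 rej eL *.
(* The index [k] ranges over ['I_n] and stands for [k + 1] rejections; there is at least one, namely
   [i]. *)
have kn : (l.-1 < n)%N by rewrite prednK.
rewrite (bigD1 (Ordinal kn))//= prednK// (maxn_idPl l0).
rewrite indicE mem_set ?mulr1 ?lerDl; last first.
  split; first by rewrite /out_event /good /= eS eU; split => //; rewrite eL prednK.
  rewrite /= in_itv/= andbT /threshold /= prednK//.
  apply: lt_le_trans rej; rewrite addrC.
  rewrite -/(E w i); apply: ltr_leD => //.
  by rewrite ler_wpM2r ?(ltW gS)// ltW// Phibar_inv_gt0.
by apply: sumr_ge0 => p _; rewrite mulr_ge0// divr_ge0.
Qed.

Let t (k : 'I_n) : R := alpha * k.+1%:R / n%:R.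

Let t_bounds k : 0 < t k /\ t k <= 4 / 10.
Proof.
have a0' := a0; have a4' := a4; have N0 := Nn0.
have k1 : k.+1%:R <= n%:R :> R by rewrite ler_nat.
have k2 : 0 < k.+1%:R :> R by rewrite ltr0n.
split; first by rewrite /t !mulr_gt0// invr_gt0.
rewrite /t ler_pdivrMr//; apply: ler_pM; lra.
Qed.

Lemma prob_rejection i k : i \in H0 pi ->
  P (out_event i k `&` eps i @^-1` `]threshold k, +oo[%classic) =
    (P (out_event i k) * (Phibar (threshold k))%:E)%E.
Proof.
move=> iH; have [ind _] := noise.
rewrite (indep_rest ind (B := `]threshold k, +oo[%classic) _ (@rest_out_event i k))//.
by rewrite (noise_H0 noise).
Qed.

(** The weight [1 / (k + 1)] cancels the linear growth of the BH levels, which leaves a bound free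
    of [k]. *)
Lemma threshold_bound (k : 'I_n) : Phibar (threshold k) / k.+1%:R <=
  alpha / n%:R * (1 + 60 * (56 * r)) + 5 * expR (- (3 * s ^+ 2)).
Proof.
have [t0 t4] := t_bounds k; have := tail_bound hs t0 t4.
rewrite -/(threshold k) => H.
have k2 : 1 <= k.+1%:R :> R by rewrite ler1n.
rewrite ler_pdivrMr; last by lra.
apply: (le_trans H).
rewrite [leRHS]mulrDl /t (_ : alpha * _ / _ * _ = alpha / n%:R * (1 + 60 * (56 * r)) * k.+1%:R); last by ring.
by rewrite lerD2l ler_peMr// mulr_ge0// expR_ge0.
Qed.

Lemma expR_3s : n%:R * expR (- (3 * s ^+ 2)) <= r.
Proof.
rewrite (@n_expR R n n0) -expRD /rate ler_expR; have := sqr_ge0 s; lra.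
Qed.

(** For fixed [i] the events [out_event i k] are disjoint in [k], so their probabilities sum to at
    most 1 and each null contributes at most the bound of [threshold_bound]. The errors add up to
    [8 + 60 * 56 + 5] times [r]. *)
Lemma FDP_bound : ('E_P[fun w => FDP pi (BH_plus alpha k0 (E w))] <=
  ((#|H0 pi|)%:R / n%:R * alpha + 70 * (50 * r))%:E)%E.
Proof.
pose B (p : 'I_n * 'I_n) := out_event p.1 p.2 `&` eps p.1 @^-1` `]threshold p.2, +oo[%classic.
pose c (p : 'I_n * 'I_n) : R := (p.1 \in H0 pi)%:R / p.2.+1%:R.
have mB p : measurable (B p).
  by apply: measurableI; [exact: measurable_out_event|exact: measurable_noise].
have c0 p : 0 <= c p by rewrite divr_ge0.
have mb := measurable_bad_lower eps k0.
have k0n : (k0 <= 9 * n %/ 10)%N by case/andP: hk.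
have [rp r1] := r01.
apply: (@le_trans _ _ 'E_P[fun w => (\1_(bad_lower eps k0) w + \sum_p c p * \1_(B p) w)%R])%E.
  apply: expectation_le.
  - exact: measurable_BH_plus.
  - apply: measurable_funD; first exact: measurable_indic.
    exact: measurable_sum_indic.
  - by move=> w; exact: FDP_ge0.
  - by move=> w; rewrite addr_ge0// sumr_ge0// => p _; rewrite mulr_ge0.
  - by apply: aeW => w; exact: FDP_BH_plus_le.
rewrite expectation_ge0D//; first last.
- by move=> w; rewrite sumr_ge0// => p _; rewrite mulr_ge0.
- exact: measurable_sum_indic.
rewrite expectation_indic// expectation_sum_indic//.
pose A i k := fine (P (out_event i k)).
have A0 i k : 0 <= A i k by exact: fine_ge0.
pose M := alpha / n%:R * (1 + 60 * (56 * r)) + 5 * expR (- (3 * s ^+ 2)).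
have M0 : 0 <= M.
  rewrite addr_ge0// ?mulr_ge0 ?expR_ge0// ?invr_ge0 ?(ltW a0)//.
  by rewrite addr_ge0 ?mulr_ge0 ?(ltW rp).
have sumB : (\sum_p (c p)%:E * P (B p) <= (\sum_(i in H0 pi) M)%:E)%E.
  rewrite [leLHS](_ : _ = (\sum_(i in H0 pi) \sum_k (A i k * (Phibar (threshold k) / k.+1%:R)))%:E); last first.
    rewrite -[LHS](pair_bigA _ (fun i k => (c (i, k))%:E * P (B (i, k)))%E)/= -sumEFin [RHS]big_mkcond.
    apply: eq_bigr => i _; rewrite /c /B /=; case: (boolP (i \in H0 pi)) => iH; last first.
      by rewrite big1// => k _; rewrite mul0r mul0e.
    rewrite -sumEFin; apply: eq_bigr => k _.
    rewrite prob_rejection// -(@fineK _ (P (out_event i k))) ?fin_num_measure//; last exact: measurable_out_event.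
    by rewrite -!EFinM -/(A i k); congr (_%:E); rewrite (_ : true%:R = 1 :> R)//; ring.
  rewrite lee_fin; apply: ler_sum => i iH.
  apply: (@le_trans _ _ (\sum_k A i k * M)).
    by apply: ler_sum => k _; rewrite ler_wpM2l//; exact: threshold_bound.
  rewrite -mulr_suml ler_piMl//; apply: sum_disjoint_le1.
    by move=> k; exact: measurable_out_event.
  move=> w k k' [_ e1] [_ e2]; apply: val_inj; apply: succn_inj.
  by rewrite -e1 -e2.
apply: (le_trans (leeD (prob_bad_lower n2 hs noise dom hk) sumB)).
rewrite -EFinD lee_fin sumr_const -[X in _ + X]mulr_natl /M.
have h0 : #|H0 pi|%:R <= n%:R :> R by rewrite ler_nat -[X in (_ <= X)%N](card_ord n) max_card.
have h1 : #|H0 pi|%:R * expR (- (3 * s ^+ 2)) <= r.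
  by apply: le_trans expR_3s; rewrite ler_wpM2r ?expR_ge0.
have h2 : #|H0 pi|%:R / n%:R * alpha * r <= r.
  have h01 : #|H0 pi|%:R / n%:R <= 1 :> R by rewrite ler_pdivrMr ?mul1r.
  have a4' := a4; rewrite ler_piMl ?(ltW rp)//; apply: mulr_ile1 => //; last lra.
  exact: ltW.
have h3 : r ^+ 2 <= r by rewrite expr2 ler_piMl ?(ltW rp)//; lra.
rewrite [X in 8 * r ^+ 2 + X](_ : _ = #|H0 pi|%:R / n%:R * alpha + 60 * 56 * (#|H0 pi|%:R / n%:R * alpha * r) +
  5 * (#|H0 pi|%:R * expR (- (3 * s ^+ 2)))); last by ring.
lra.
Qed.

End ErrorBound.

(** * The power bound *)

Section Power.
Context {R : realType} {n : nat}.
Local Notation s := (@sqrt_ln R n).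
Local Notation r := (@rate R n).
Local Notation z := (@Phibar_inv R).
Hypothesis n0 : (0 < n)%N.
Hypothesis hs : 40 * 50 <= s.
Variables (kap t b : R).
Hypothesis kap_n : n%:R^-1 <= kap.
Hypothesis kap1 : kap <= 1.
Hypothesis t0 : 0 < t.
Hypothesis t4 : t <= 4 / 10.
Hypothesis b1 : 1 <= b.
Hypothesis tb : kap / b <= t.

Let K := 120 * kap + 20 * r.
(** An upper bound of [K * (z t + 1)]: [K] is at most 140, and the parts of [K * ln kap^-1] coming
    from [kap] and [r] are at most 120 and [20 * 16]; twice their sum is below [30 * 30]. *)
Definition power_const (b : R) := 140 * (2 * ln b + 2) + 30 * 30.
Hypothesis hK2 : 60 * power_const b <= s.

Let kap0 : 0 < kap.
Proof. by apply: lt_le_trans kap_n; rewrite invr_gt0 ltr0n. Qed.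

Lemma mul_ln_inv_le1 (x : R) : 0 < x -> x * ln x^-1 <= 1.
Proof.
move=> x0; have xi : 0 < x^-1 by rewrite invr_gt0.
have h : ln x^-1 <= x^-1.
  rewrite -[leRHS]expRK ler_ln ?posrE ?expR_gt0//.
  by have := expR_ge1Dx x^-1; lra.
by have := ler_wpM2l (ltW x0) h; rewrite mulfV ?gt_eqF.
Qed.

(** Since [t] is at least [kap / b], the squared quantile is at most [2 * ln b + 2 * ln kap^-1], and
    the bias [K] tames this logarithm. So [(z t + 1) * h] is at most [3 * power_const b / s], and
    [Phibar_drop] inflates the tail by at most [48 * power_const b / s]. *)
Lemma power_drop (e U S x : R) : 48 * power_const b <= e * s ->
  0 < S -> S <= 1 + K / s ^+ 2 -> U <= K / s -> z t <= x ->
  Phibar ((x - U) / S) <= t * (1 + e).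
Proof.
move=> he S0 S1 U1 zx; have hs' := hs; have s0 : 0 < s by lra.
have [rp rs] := @r_small R n; have r1 := r_le hs.
have t0' := t0; have t4' := t4; have kap0' := kap0; have kap1' := kap1; have b1' := b1.
have z1 : 1 / 10 <= z t by exact: Phibar_inv_ge_tenth.
have A0 : 0 <= ln b by exact: ln_ge0.
have K2 : 30 * 30 <= power_const b by rewrite /power_const; lra.
have hK2' := hK2.
have K0 : 0 <= K by rewrite /K; lra.
have K1 : K <= 140 by rewrite /K; lra.
have lnk : ln kap^-1 <= s ^+ 2.
  rewrite -[leRHS]expRK -(@n_expR R n n0) ler_ln ?posrE ?invr_gt0 ?ltr0n//.
  by rewrite -[leRHS]invrK lef_pV2 ?posrE ?invr_gt0 ?ltr0n.
have lnk0 : 0 <= ln kap^-1 by rewrite ln_ge0// invf_ge1.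
have zz : z t ^+ 2 <= 2 * ln b + 2 * ln kap^-1.
  apply: (le_trans (Phibar_inv_sqr t0 _)); first by lra.
  rewrite -mulrDr ler_pM2l// -lnM ?posrE ?invr_gt0//; last by lra.
  rewrite ler_ln ?posrE ?invr_gt0 ?mulr_gt0 ?invr_gt0//; last by lra.
  by rewrite -[leRHS]invrK lef_pV2 ?posrE ?invr_gt0 ?mulr_gt0 ?invr_gt0// ?invfM ?invrK 1?mulrC//; lra.
have z2 : z t <= 2 * s.
  rewrite -(@ler_pXn2r _ 2) ?nnegrE ?exprMn; [|by []|lra|lra].
  have : s <= s ^+ 2 by rewrite expr2 ler_peMl//; lra.
  have : ln b <= s by have := hK2'; rewrite /power_const; lra.
  have : 2 ^+ 2 * s ^+ 2 = 4 * s ^+ 2 :> R by ring.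
  lra.
have Kz : K * (z t + 1) <= power_const b.
  have h1 : kap * ln kap^-1 <= 1 by exact: mul_ln_inv_le1.
  have h2 : r * ln kap^-1 <= 16 by apply: le_trans rs; rewrite ler_wpM2l// ltW.
  have h3 : z t + 1 <= z t ^+ 2 + 2.
    by have := sqr_ge0 (z t - 1 / 2); rewrite sqrrB; lra.
  have h4 : K * (z t + 1) <= K * (2 * ln b + 2 * ln kap^-1 + 2) by rewrite ler_wpM2l//; lra.
  have h5 : K * (2 * ln b + 2) <= 140 * (2 * ln b + 2) by rewrite ler_wpM2r//; lra.
  have h6 : K * ln kap^-1 = 120 * (kap * ln kap^-1) + 20 * (r * ln kap^-1) by rewrite /K; ring.
  rewrite /power_const; lra.
pose h := K / s + K / s ^+ 2 * z t.
have z0 : 0 <= z t by lra.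
have Ks0 : 0 <= K / s by rewrite divr_ge0 ?(ltW s0).
have Kss0 : 0 <= K / s ^+ 2 by rewrite divr_ge0 ?exprn_ge0 ?(ltW s0).
have h0 : 0 <= h by rewrite addr_ge0// mulr_ge0.
have hle : h <= 3 * (K / s).
  have : K / s ^+ 2 * z t <= K / s ^+ 2 * (2 * s).
    by rewrite ler_wpM2l.
  rewrite (_ : K / s ^+ 2 * (2 * s) = 2 * (K / s)); last by field; rewrite gt_eqF.
  by rewrite /h; lra.
have hz : (z t + 1) * h <= 3 * (power_const b / s).
  have : (z t + 1) * h <= (z t + 1) * (3 * (K / s)) by rewrite ler_wpM2l//; lra.
  have : K * (z t + 1) / s <= power_const b / s by rewrite ler_pM2r ?invr_gt0.
  rewrite (_ : (z t + 1) * (3 * (K / s)) = 3 * (K * (z t + 1) / s)); last by ring.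
  lra.
have ps : power_const b / s <= 1 / 60 by rewrite ler_pdivrMr//; lra.
have pse : 48 * (power_const b / s) <= e by rewrite mulrA ler_pdivrMr.
have zh0 : 0 <= z t * h by rewrite mulr_ge0.
have hsm : h <= 1 / 20 by lra.
have Ks : K / s <= z t.
  have : K / s <= h by rewrite /h lerDl mulr_ge0.
  lra.
(* The shift [h] adds the location error [K / s] and the scale error [K / s ^+ 2] at [z t]; the
   second-order term has the favourable sign. *)
have xh : z t - h <= (x - U) / S.
  rewrite ler_pdivlMr//.
  have a1 : z t - K / s <= x - U by lra.
  apply: le_trans a1.
  have zhp : 0 <= z t - h by lra.
  have a2 : (z t - h) * S <= (z t - h) * (1 + K / s ^+ 2) by rewrite ler_wpM2l.
  apply: (le_trans a2).
  have a3 : 0 <= K / s ^+ 2 * h by rewrite mulr_ge0.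
  by rewrite /h in a3 *; lra.
apply: (le_trans (Phibar_noninc xh)).
apply: (le_trans (@Phibar_drop _ (z t) h h0 _)); first by lra.
rewrite Phibar_invK; last by lra.
rewrite ler_pM2l// lerD2l.
have E2 : expR (z t * h) <= 2 by apply: expR_le2; lra.
have p : 0 <= 8 * (z t + 1) * h by apply: mulr_ge0 => //; lra.
have : 8 * (z t + 1) * h * expR (z t * h) <= 8 * (z t + 1) * h * 2 by rewrite ler_wpM2l.
lra.
Qed.

End Power.

Section PartTwo.
Context {R : realType} {n : nat} d (T : measurableType d) (P : probability T R).
Variables (pi : 'I_n -> probability (measurableTypeR R) R).
Variables (eps : 'I_n -> {RV P >-> measurableTypeR R}).
Variables (alpha : R) (k0 : nat).
Local Notation s := (@sqrt_ln R n).
Local Notation r := (@rate R n).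
Local Notation z := (@Phibar_inv R).
Hypothesis n2 : (2 <= n)%N.
Hypothesis noise : OSC_noise pi eps.
Hypothesis a0 : 0 < alpha.
Hypothesis a4 : alpha < 4 / 10.
Hypothesis hs : 40 * 50 <= s.
Hypothesis dom : forall i, dominates_normal (pi i).
Hypothesis hk : (n1 pi <= k0 <= 9 * n %/ 10)%N.
Variables (C eta e : R).
Hypothesis C1 : 1 <= C.
Hypothesis eta0 : 0 < eta < 1.
Hypothesis e0 : 0 < e.
Hypothesis k0_n1 : k0%:R / n%:R <= C * ((n1 pi)%:R / n%:R).
(** An oracle that rejects at least [eta * n1] hypotheses works at a level at least
    [alpha * eta * n1 / n], hence at least [(k0 / n) / b]. *)
Let b := C / (alpha * eta).
Hypothesis hK2 : 60 * power_const b <= s.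
Hypothesis he : 48 * power_const b <= e * s.

Let E w i := eps i w.
Let n0 : (0 < n)%N. Proof. exact: ltn_trans n2. Qed.
Let Nn0 : 0 < n%:R :> R. Proof. by rewrite ltr0n. Qed.

Lemma TDP_ge0 (D : {set 'I_n}) : 0 <= TDP pi D.
Proof. by rewrite /TDP divr_ge0. Qed.

Lemma TDP_le1 (D : {set 'I_n}) : TDP pi D <= 1.
Proof.
rewrite /TDP ler_pdivrMr ?mul1r ?ltr0n ?leq_max ?orbT// ler_nat leq_max.
by rewrite subset_leq_card ?subsetIr.
Qed.

Lemma TDP_mono (D D' : {set 'I_n}) : (D \subset D')%SET -> TDP pi D <= TDP pi D'.
Proof.
move=> DD'; rewrite /TDP ler_wpM2r ?invr_ge0// ler_nat subset_leq_card//.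
exact: finset.setSI.
Qed.

(* An oracle TDP of at least [eta] forces the oracle threshold to be of order at least
   [eta * n1 / n], hence of the order of the bias [k0 / n] of the estimators. *)
Lemma BH_oracle_subset w : ~ (bad_lower eps k0 w \/ bad_upper eps k0 w) ->
  eta <= TDP pi (BH alpha (E w) 0 1) ->
  (BH alpha (E w) 0 1 \subset BH_plus (alpha * (1 + e)) k0 (E w))%SET.
Proof.
move=> /not_orP[nl nu] heta; have /andP[eta1 eta2] := eta0.
have k0n : (k0 <= 9 * n %/ 10)%N by case/andP: hk.
have [gS gU] := good_lower n2 hs hk nl.
have [gS' gU'] := good_upper n2 hs hk nu.
have a0' := a0; have a4' := a4; have e0' := e0; have C1' := C1; have N0 := Nn0.
have S0 : 0 < sigma_plus k0 (E w) by have := sigma_lower_half hs gS; lra.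
set l := #|BH alpha (E w) 0 1|.
(* With no contamination the TDP would be 0, below [eta]; so [k0] is at least 1 and [k0 / n] at
   least [1 / n]. *)
have n1pos : (0 < n1 pi)%N.
  rewrite lt0n; apply/negP => /eqP h; move: heta; rewrite /TDP.
  by rewrite (cards0_eq h) finset.setI0 cards0 mul0r; lra.
have lge : eta * (n1 pi)%:R <= l%:R.
  move: heta; rewrite /TDP (maxn_idPl n1pos) ler_pdivlMr ?ltr0n// => /le_trans; apply.
  by rewrite ler_nat subset_leq_card// subsetIl.
have n1r : 1 <= (n1 pi)%:R :> R by rewrite ler1n.
have lpos : 0 < l%:R :> R by apply: lt_le_trans lge; rewrite mulr_gt0//; lra.
have lle : l%:R <= n%:R :> R by rewrite ler_nat -[X in (_ <= X)%N](card_ord n) max_card.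
set t := alpha * l%:R / n%:R.
have t0 : 0 < t by rewrite !mulr_gt0// invr_gt0.
have t4 : t <= 4 / 10 by rewrite /t ler_pdivrMr//; apply: ler_pM; lra.
have ae0 : 0 < alpha * eta by rewrite mulr_gt0.
have kapn : n%:R^-1 <= k0%:R / n%:R :> R.
  rewrite -[leLHS]mul1r ler_pM2r ?invr_gt0// ler1n.
  by case/andP: hk => h _; exact: leq_trans h.
have kap1 : k0%:R / n%:R <= 1 :> R.
  have /andP[h _] := @N'_bounds R n k0 k0n; rewrite ler_pdivrMr// mul1r; lra.
have b1 : 1 <= b.
  rewrite /b ler_pdivlMr// mul1r; apply: le_trans C1'.
  by apply: mulr_ile1; lra.
have tb : k0%:R / n%:R / b <= t.
  rewrite ler_pdivrMr; last by lra.
  apply: (le_trans k0_n1).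
  rewrite /t /b (_ : alpha * l%:R / n%:R * (C / (alpha * eta)) = C * (l%:R / eta / n%:R)); last first.
    by field; rewrite !gt_eqF.
  rewrite ler_wpM2l ?ler_wpM2r ?invr_ge0 ?(ltW N0)//; first lra.
  by rewrite ler_pdivlMr// mulrC.
apply: BH_subset; [lra|by rewrite mulr_ge0//; lra|move=> i iB].
have lE : BH_ell alpha (pvalue (E w) 0 1) = l by rewrite /l card_BH// ltW.
rewrite lE (_ : alpha * (1 + e) * l%:R / n%:R = t * (1 + e)); last by rewrite /t; ring.
apply: (power_drop n0 hs kapn kap1 t0 t4 b1 tb hK2 he S0 gS' gU').
rewrite Phibar_inv_le; last by lra.
by move: iB; rewrite inE lE /pvalue subr0 divr1.
Qed.

(** Off the bad events either the oracle TDP is below [eta] or the oracle rejections are all kept;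
    the bad events have total probability at most [16 * r ^+ 2]. *)
Lemma TDP_bound : ('E_P[fun w => TDP pi (BH alpha (E w) 0 1)] <=
  'E_P[fun w => TDP pi (BH_plus (alpha * (1 + e)) k0 (E w))] + (eta + 16 * r)%:E)%E.
Proof.
have /andP[eta1 eta2] := eta0; have [rp _] := @r_small R n; have r1 := r_le hs.
have me i : measurable_fun setT (eps i : T -> R) := measurable_eps eps i.
have m1 : measurable_fun setT (fun w => TDP pi (BH alpha (E w) 0 1)).
  have mc (x : R) : measurable_fun setT (fun _ : T => x) by exact: measurable_cst.
  have H := @measurable_BH_fun R _ T n (fun i => eps i : T -> R) me (fun=> 0) (fun=> 1)
    (mc 0) (mc 1) alpha (TDP pi).
  exact: H.
have m2 := measurable_BH_plus eps k0 (alpha * (1 + e)) (TDP pi).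
have ml := measurable_bad_lower eps k0; have mu := measurable_bad_upper eps k0.
have mb : measurable (bad_lower eps k0 `|` bad_upper eps k0) by exact: measurableU.
apply: (@le_trans _ _ 'E_P[fun w => (TDP pi (BH_plus (alpha * (1 + e)) k0 (E w)) +
   (cst eta w + \1_(bad_lower eps k0 `|` bad_upper eps k0) w))%R])%E.
  apply: expectation_le => //.
  - by apply: measurable_funD => //; apply: measurable_funD => //; exact: measurable_indic.
  - by move=> w; exact: TDP_ge0.
  - by move=> w; rewrite !addr_ge0 ?TDP_ge0//= ltW.
  apply: aeW => w /=; case: (pselect (bad_lower eps k0 w \/ bad_upper eps k0 w)) => b0.
    rewrite indicE mem_set// (_ : true%:R = 1 :> R)//.
    by have := TDP_le1 (BH alpha (E w) 0 1); have := TDP_ge0 (BH_plus (alpha * (1 + e)) k0 (E w)); lra.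
  rewrite indicE memNset// addr0; case: (leP eta (TDP pi (BH alpha (E w) 0 1))) => h.
    by apply: ler_wpDr; [lra|exact/TDP_mono/BH_oracle_subset].
  by have := TDP_ge0 (BH_plus (alpha * (1 + e)) k0 (E w)); lra.
rewrite expectation_ge0D//; first last.
- by move=> w; rewrite addr_ge0//= ltW.
- by move=> w; exact: TDP_ge0.
- by apply: measurable_funD => //; exact: measurable_indic.
rewrite leeD2l// expectation_ge0D//; last by move=> w /=; lra.
rewrite expectation_cst expectation_indic// EFinD leeD2l//.
apply: (le_trans (measureU2 _ _ _)) => //.
apply: (le_trans (leeD (prob_bad_lower n2 hs noise dom hk) (prob_bad_upper n2 hs noise dom hk))).
rewrite -EFinD lee_fin; have : r ^+ 2 <= r by rewrite expr2 ler_piMl ?(ltW rp)//; lra.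
lra.
Qed.

End PartTwo.

(** * From the finite-sample bounds to the theorem *)

Section Limsup.
Context {R : realType}.

Lemma limn_esup_le0 (u : nat -> \bar R) :
  (forall eta : R, 0 < eta -> exists N, forall n, (N <= n)%N -> (u n <= eta%:E)%E) ->
  (limn_esup u <= 0)%E.
Proof.
move=> H; apply/lee_addgt0Pr => x x0; rewrite add0e.
have [N hN] := H x x0; rewrite /limn_esup limf_esupE.
apply: (@le_trans _ _ (ereal_sup (u @` [set n | (N <= n)%N]))).
  apply: ereal_inf_lbound; exists [set n | (N <= n)%N] => //.
  by exists N => // n.
by apply: ge_ereal_sup => _ [n /= Nn <-]; exact: hN.
Qed.

Lemma sqrt_ln_large (M : R) : exists N, forall n, (N <= n)%N -> M <= @sqrt_ln R n.
Proof.
exists (Num.truncn (expR (M ^+ 2))).+1 => n nN.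
have h : expR (M ^+ 2) <= n%:R.
  by apply: ltW; apply: (lt_le_trans (truncnS_gt _)); rewrite ler_nat.
have n0 : 0 < n%:R :> R by apply: lt_le_trans h; exact: expR_gt0.
apply: (le_trans (ler_norm _)); rewrite -sqrtr_sqr /sqrt_ln ler_wsqrtr//.
by rewrite -[leLHS]expRK ler_ln ?posrE ?expR_gt0.
Qed.

End Limsup.

Lemma expectation_fin_num {R : realType} d (T : measurableType d) (P : probability T R)
    (X : T -> R) : measurable_fun setT X -> (forall w, 0 <= X w <= 1) ->
  ('E_P[X] \is a fin_num)%E.
Proof.
move=> mX X01; rewrite ge0_fin_numE; last first.
  by apply: expectation_ge0 => w; case/andP: (X01 w).
by apply: (@le_lt_trans _ _ 1%E); [exact: expectation_le1|exact: ltry].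
Qed.

Lemma rate_le {R : realType} n (eta eta' : R) : 0 < eta -> 40 * 50 <= sqrt_ln n :> R ->
  8 * 64 / eta <= sqrt_ln n -> eta' <= eta / 4 -> eta' + 16 * rate n <= eta.
Proof.
move=> eta0 hs h4 h; have [rp rs] := @r_small R n.
have s1 : sqrt_ln n <= sqrt_ln n ^+ 2 :> R by rewrite expr2 ler_peMl//; lra.
have : rate n * (8 * 64 / eta) <= 16 :> R.
  by apply: le_trans rs; rewrite ler_wpM2l ?(ltW rp)//; lra.
rewrite mulrA ler_pdivrMr//; lra.
Qed.

Lemma leB_of_leD {R : realType} (A A' B B' : \bar R) (x y : R) :
  A = A' -> B = B' -> B' \is a fin_num -> (A' <= B' + x%:E)%E -> x <= y ->
  (A - B <= y%:E)%E.
Proof.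
move=> -> -> B'f h xy; rewrite leeBlDl//; apply: (le_trans h).
by rewrite leeD2l// lee_fin.
Qed.

Theorem theorem5p2 (R : realType) :
  (exists2 c : R, 0 < c &
    forall (n : nat) (alpha theta sigma : R)
      (pi : 'I_n -> probability (measurableTypeR R) R) (k0 : nat)
      (d : measure_display) (T : measurableType d) (P : probability T R)
      (eps : 'I_n -> {RV P >-> measurableTypeR R}),
    (2 <= n)%N -> 0 < alpha < 4 / 10 -> 0 < sigma ->
    Mbar (9 * n %/ 10) pi ->
    (n1 pi <= k0 <= 9 * n %/ 10)%N ->
    OSC_noise pi eps ->
    (maxe ('E_P[fun w => FDP pi (BH_plus alpha k0 (OSC_obs theta sigma eps w))]
           - ((n0 pi)%:R / n%:R * alpha)%:E) 0
     <= (c * (ln n%:R / n%:R `^ (1 / 16)))%:E)%E)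
  /\
  (forall alpha : R, 0 < alpha < 4 / 10 ->
    forall (e : nat -> R)
      (pi : forall n : nat, 'I_n -> probability (measurableTypeR R) R)
      (k0 : nat -> nat),
    (forall n, (2 <= n)%N -> 0 < e n < 1) ->
    e n @[n --> \oo] --> 0 ->
    e n * Num.sqrt (ln n%:R) @[n --> \oo] --> +oo ->
    (forall n, (2 <= n)%N -> Mbar (9 * n %/ 10) (pi n)) ->
    (forall n, (2 <= n)%N -> (n1 (pi n) <= k0 n <= 9 * n %/ 10)%N) ->
    same_order (fun n => (n1 (pi n))%:R / n%:R : R) (fun n => (k0 n)%:R / n%:R) ->
    forall (theta sigma : R), 0 < sigma ->
    forall (d : nat -> measure_display) (T : forall n, measurableType (d n))
      (P : forall n, probability (T n) R)
      (eps : forall n, 'I_n -> {RV (P n) >-> measurableTypeR R}),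
    (forall n, (2 <= n)%N -> OSC_noise (pi n) (eps n)) ->
    (limn_esup (fun n =>
       'E_(P n)[fun w => TDP (pi n) (BH alpha (OSC_obs theta sigma (eps n) w) theta sigma)]
       - 'E_(P n)[fun w => TDP (pi n)
           (BH_plus (alpha * (1 + e n)) (k0 n) (OSC_obs theta sigma (eps n) w))])
     <= 0)%E).
Proof.
split.
  have l2 : 0 < ln 2 :> R by rewrite ln_gt0// ltr1n.
  (* A lower bound of [ln n * rate n] over the [n] with [sqrt_ln n] below [40 * 50]: the constant
     [M = m^-1] makes the claimed bound at least 1, hence trivial, for these [n]. *)
  pose m : R := ln 2 * expR (- ((40 * 50) ^+ 2 / 16)).
  have m0 : 0 < m by rewrite mulr_gt0 ?expR_gt0.
  have [M M0 M1] : exists2 M : R, 0 < M & M * m = 1.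
    by exists m^-1; rewrite ?invr_gt0// mulVf// gt_eqF.
  exists (M + 70 * 50); first lra.
  move=> n alpha theta sigma pi k0 d T P eps n2 /andP[a0 a4] sigma0 [dom _] hk noise.
  have n0 : (0 < n)%N by exact: ltn_trans n2.
  have nr : 2 <= n%:R :> R by rewrite ler_nat.
  have -> : (fun w => FDP pi (BH_plus alpha k0 (OSC_obs theta sigma eps w))) =
      (fun w => FDP pi (BH_plus alpha k0 (fun i => eps i w))).
    by apply/funext => w; rewrite -[in RHS](BH_plus_affine n2 alpha k0 _ theta sigma0).
  have mF : measurable_fun setT (fun w => FDP pi (BH_plus alpha k0 (fun i => eps i w))).
    exact: measurable_BH_plus.
  have lnn : ln 2 <= ln n%:R :> R by rewrite ler_ln ?posrE ?ltr0n//.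
  have rE : ln n%:R / n%:R `^ (1 / 16) = ln n%:R * rate n :> R.
    by rewrite (@powR_expR R n n0) /rate expRN; congr (_ / expR _); ring.
  have rp : 0 < rate n :> R by exact: expR_gt0.
  have lnr0 : 0 <= ln n%:R * rate n :> R by rewrite mulr_ge0 ?(ltW rp)//; lra.
  rewrite ge_max rE; apply/andP; split; last first.
    by rewrite lee_fin mulr_ge0 ?lnr0//; lra.
  rewrite leeBlDr//; case: (leP (40 * 50 : R) (sqrt_ln n)) => hs.
    apply: (le_trans (FDP_bound n2 noise a0 a4 hs dom hk)).
    rewrite -EFinD lee_fin addrC lerD2r.
    have ln1 : 1 <= ln n%:R :> R.
      by rewrite (@n_expR R n n0) expRK expr_ge1//; lra.
    have h1 : rate n <= ln n%:R * rate n :> R by rewrite ler_peMl// ltW.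
    have h2 : 0 <= M * (ln n%:R * rate n) by rewrite mulr_ge0// ltW.
    rewrite mulrDl; lra.
  apply: (@le_trans _ _ 1%E).
    by apply: expectation_le1 => // w; rewrite FDP_ge0 FDP_le1.
  rewrite -EFinD lee_fin; apply: ler_wpDr.
    by rewrite mulr_ge0 ?divr_ge0// ltW.
  have h : expR (- ((40 * 50) ^+ 2 / 16)) <= rate n :> R.
    rewrite /rate ler_expR lerN2 ler_pM2r// ler_sqr ?nnegrE ?sqrtr_ge0//; lra.
  have h1 : 1 <= M * (ln n%:R * rate n).
    apply: (@le_trans _ _ (M * m)); first by rewrite M1.
    by apply: ler_wpM2l; [exact: ltW|apply: ler_pM => //; exact: ltW].
  rewrite mulrDl; lra.
move=> alpha /andP[a0 a4] e pi k0 e01 _ eoo hM hk [C C0 hC] theta sigma sigma0 d T P eps noise.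
apply: limn_esup_le0 => eta eta0.
set eta' := Num.min (eta / 4) (1 / 2).
have eta'0 : 0 < eta' < 1.
  by rewrite lt_min gt_min; apply/andP; split; [apply/andP; split; lra|apply/orP; right; lra].
have eta'1 : eta' <= eta / 4 by rewrite ge_min lexx.
set C' := Num.max C 1.
have C'1 : 1 <= C' by rewrite le_max lexx orbT.
(* This constant does not depend on [n], so each of the conditions below holds from some rank on. *)
set b := C' / (alpha * eta').
have [N1 hN1] := @sqrt_ln_large R (40 * 50).
have [N2 hN2] := @sqrt_ln_large R (60 * power_const b).
(* The growth of [e n * sqrt (ln n)] makes the enlarged level eventually absorb the inflation
   [48 * power_const b / s] of the p-values. *)
have [N3 _ hN3] : \forall n \near \oo, 48 * power_const b <= e n * Num.sqrt (ln n%:R).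
  by move/cvgryPge : eoo; apply.
have [N4 hN4] := @sqrt_ln_large R (8 * 64 / eta).
exists (maxn (maxn N1 N2) (maxn (maxn N3 N4) 2)) => n; rewrite !geq_max.
move=> /andP[/andP[n1' n2'] /andP[/andP[n3' n4'] n2]].
have hs := hN1 n n1'.
have [dom _] := hM n n2.
have /andP[e0 _] := e01 n n2.
have hCn : (k0 n)%:R / n%:R <= C' * ((n1 (pi n))%:R / n%:R).
  have [_ h] := hC n n2; apply: (le_trans h); rewrite ler_wpM2r ?divr_ge0//.
  by rewrite le_max lexx.
pose E (w : T n) (i : 'I_n) : R := eps n i w.
have EX : ('E_(P n)[fun w => TDP (pi n) (BH alpha (OSC_obs theta sigma (eps n) w) theta sigma)] =
    'E_(P n)[fun w => TDP (pi n) (BH alpha (E w) 0 1)])%E.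
  apply: (congr1 (@expectation _ (T n) R (P n))); apply/funext => w.
  by apply: (congr1 (TDP (pi n))); rewrite -(BH_oracle_affine alpha (E w) theta sigma0).
have EY : ('E_(P n)[fun w => TDP (pi n)
      (BH_plus (alpha * (1 + e n)) (k0 n) (OSC_obs theta sigma (eps n) w))] =
    'E_(P n)[fun w => TDP (pi n) (BH_plus (alpha * (1 + e n)) (k0 n) (E w))])%E.
  apply: (congr1 (@expectation _ (T n) R (P n))); apply/funext => w.
  by apply: (congr1 (TDP (pi n))); rewrite -(BH_plus_affine n2 _ (k0 n) (E w) theta sigma0).
have H := @TDP_bound R n _ _ (P n) (pi n) (eps n) alpha (k0 n) n2 (noise n n2) a0 a4 hs dom
  (hk n n2) C' eta' (e n) C'1 eta'0 e0 hCn (hN2 n n2') (hN3 n n3').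
have Yfin : ('E_(P n)[fun w => TDP (pi n) (BH_plus (alpha * (1 + e n)) (k0 n) (E w))]
    \is a fin_num)%E.
  apply: expectation_fin_num; last by move=> w; rewrite TDP_ge0 TDP_le1.
  exact: measurable_BH_plus.
have r1 : eta' + 16 * rate n <= eta by exact: (rate_le eta0 hs (hN4 n n4') eta'1).
exact: (leB_of_leD EX EY Yfin H r1).
Qed.
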